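(* Let $a>1$, let $\Psi=\{\psi_1,\psi_2,\dots,\psi_L\}$ be a finite subset of $L^2(\mathbb{R}_+)$ with cardinality $L$, and let $\mathcal{MD}(\Psi,a)$ be a frame for $L^2(\mathbb{R}_+)$. Then $\mathcal{MD}(\Psi,a)$ is a Riesz basis for $L^2(\mathbb{R}_+)$ if and only if $L=1$.
   Context: $\mathbb{R}_+=(0,\infty)$, and $L^2(\mathbb{R}_+)$ is the space of complex-valued square-integrable functions on $\mathbb{R}_+$. A measurable function $h$ on $\mathbb{R}_+$ is $a$-dilation periodic if $h(ax)=h(x)$ for a.e. $x\in\mathbb{R}_+$. For $m\in\mathbb{Z}$, $\Lambda_m$ is the $a$-dilation periodic function on $\mathbb{R}_+$ determined by $\Lambda_m(x)=\frac{1}{\sqrt{a-1}}e^{\frac{2\pi i m x}{a-1}}$ for $x\in[1,a)$. For $c>0$, $D_c f(x)=\sqrt{c}\,f(cx)$. The dilation-and-modulation system is $\mathcal{MD}(\Psi,a)=\{\Lambda_m D_{a^j}\psi_l:\ m,j\in\mathbb{Z},\ 1\le l\le L\}$ (indexed by $(m,j,l)$). It is a frame for $L^2(\mathbb{R}_+)$ if there are $0<C_1\le C_2<\infty$ with $C_1\|f\|^2\le\sum_{l=1}^{L}\sum_{m,j\in\mathbb{Z}}|\langle f,\Lambda_m D_{a^j}\psi_l\rangle|^2\le C_2\|f\|^2$ for all $f\in L^2(\mathbb{R}_+)$. *)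

(* Defs.v *)
From HB Require Import structures.
From mathcomp Require Import all_boot all_order all_algebra finmap.
From mathcomp Require Import all_classical all_reals all_analysis.
From mathcomp Require Import complex.

Set Implicit Arguments.
Unset Strict Implicit.
Unset Printing Implicit Defensive.

Import Order.TTheory GRing.Theory Num.Theory.
Import numFieldNormedType.Exports.
Import ComplexField.Normc.

Local Open Scope classical_set_scope.
Local Open Scope ring_scope.

(* Elements of L^2(0, oo) are represented by functions [R -> R[i]], of which
   only the values on ]0, +oo[ matter; two of them denote the same element of
   L^2 when they are equal almost everywhere on ]0, +oo[.  Measurability on R
   is Borel measurability, which every class in L^2 admits a representative
   for. *)
Section L2.
Context {R : realType}.
Implicit Types f g : R -> R[i].

Definition Rplus : set R := `]0, +oo[%classic.

Definition eqL2 f g := f = g %[ae (@lebesgue_measure R) in Rplus].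

(* squared norm, in [\bar R] because it may be infinite *)
Definition normL2sq f : \bar R :=
  (\int[@lebesgue_measure R]_(x in Rplus) ((normc (f x)) ^+ 2)%:E)%E.

Definition L2 f : Prop :=
  [/\ measurable_fun Rplus (fun x => complex.Re (f x)),
      measurable_fun Rplus (fun x => complex.Im (f x)) &
      (normL2sq f < +oo)%E].

Definition cintegral f : R[i] :=
  ((\int[@lebesgue_measure R]_(x in Rplus) complex.Re (f x))
   +i* (\int[@lebesgue_measure R]_(x in Rplus) complex.Im (f x)))%C.

Definition innerL2 f g : R[i] := cintegral (fun x => f x * (g x)^*%C).

End L2.

Section Families.
Context {R : realType} {I : choiceType}.
Implicit Type e : I -> R -> R[i].

Definition is_frame e : Prop :=
  (forall i, L2 (e i)) /\
  exists C1 C2 : R, [/\ 0 < C1, C1 <= C2 &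
    forall f, L2 f ->
      (C1%:E * normL2sq f <=
         \esum_(i in [set: I]) ((normc (innerL2 f (e i))) ^+ 2)%:E)%E /\
      (\esum_(i in [set: I]) ((normc (innerL2 f (e i))) ^+ 2)%:E <=
         C2%:E * normL2sq f)%E].

Definition lincomb e (F : {fset I}) (c : I -> R[i]) : R -> R[i] :=
  fun x => \sum_(i <- F) c i * e i x.

(* the linear span of the family is dense in L^2(0, oo) *)
Definition is_complete e : Prop :=
  forall f, L2 f -> forall eps : R, 0 < eps ->
    exists (F : {fset I}) (c : I -> R[i]),
      (normL2sq (fun x => (f x - lincomb e F c x)%R) < eps%:E)%E.

Definition is_riesz_basis e : Prop :=
  [/\ forall i, L2 (e i),
      is_complete e &
      exists C1 C2 : R, [/\ 0 < C1, C1 <= C2 &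
        forall (F : {fset I}) (c : I -> R[i]),
          ((C1 * \sum_(i <- F) normc (c i) ^+ 2)%:E <=
             normL2sq (lincomb e F c))%E /\
          (normL2sq (lincomb e F c) <=
             (C2 * \sum_(i <- F) normc (c i) ^+ 2)%:E)%E]].

End Families.

Section DilationModulation.
Context {R : realType}.

Definition expi (t : R) : R[i] := (cos t +i* sin t)%C.

(* a ^ (dilexp a x) <= x < a ^ (dilexp a x + 1), for 1 < a and 0 < x *)
Definition dilexp (a x : R) : int := Num.floor (ln x / ln a).

(* The values of Lambda_m outside [1, a[ are obtained by rescaling the
   argument into [1, a[; see Lambda_fundamental and Lambda_periodic. *)
Definition Lambda (a : R) (m : int) (x : R) : R[i] :=
  ((Num.sqrt (a - 1))^-1)%:C%C *
  expi (2 * pi * m%:~R * (x / a ^ dilexp a x) / (a - 1)).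

Definition dil (c : R) (f : R -> R[i]) (x : R) : R[i] :=
  (Num.sqrt c)%:C%C * f (c * x).

Definition MD (L : nat) (psi : 'I_L -> R -> R[i]) (a : R)
    (i : int * int * 'I_L) : R -> R[i] :=
  fun x => let: (m, j, l) := i in Lambda a m x * dil (a ^ j) (psi l) x.

Lemma Lambda_fundamental (a : R) (m : int) (x : R) : 1 < a -> 1 <= x < a ->
  Lambda a m x = ((Num.sqrt (a - 1))^-1)%:C%C *
                 expi (2 * pi * m%:~R * x / (a - 1)).
Proof.
move=> a1 /andP[x1 xa].
have lna : 0 < ln a by rewrite ln_gt0.
have x0 : 0 < x by apply: lt_le_trans x1.
suff dx : dilexp a x = 0 by rewrite /Lambda dx expr0z divr1.
apply: floor_def; rewrite mulr0z add0r mulr1z.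
apply/andP; split; first by apply: divr_ge0; [exact: ln_ge0 | exact: ltW].
by rewrite ltr_pdivrMr// mul1r ltr_ln ?posrE// (lt_trans x0 xa).
Qed.

Lemma Lambda_periodic (a : R) (m : int) (x : R) : 1 < a -> 0 < x ->
  Lambda a m (a * x) = Lambda a m x.
Proof.
move=> a1 x0.
have lna : 0 < ln a by rewrite ln_gt0.
have a0 : 0 < a by apply: lt_trans a1.
rewrite /Lambda (_ : dilexp a (a * x) = 1 + dilexp a x).
  rewrite expfzDr ?gt_eqF// expr1z -mulf_div divff ?gt_eqF// mul1r//.
rewrite /dilexp lnM ?posrE// mulrDl divff ?gt_eqF//.
by rewrite floorDzr ?floor1// int_num1.
Qed.

End DilationModulation.

(* Main.v *)
Require Import Defs.
From HB Require Import structures.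
From mathcomp Require Import all_boot all_order all_algebra finmap.
From mathcomp Require Import all_classical all_reals all_analysis.
From mathcomp Require Import measurable_realfun complex zify ring lra.

(** For [g = (m, j)] in the group [int * int] and a function [u], call
    [Lambda_m D_{a^j} u] the atom of [u] at [g].  Multiplication by [Lambda_m]
    and the dilations commute and are unitary up to a constant, so the inner
    product of the atom of [u] at [g] with the atom of [v] at [h] depends only
    on [h - g] ([inner_atom]).  For [u] the indicator of [[1, a)] the atoms
    [phi_g] form an orthonormal system ([atom_box_orthonormal]) with dense span
    ([box_atom_dense]).  Hence [L^2(0, oo)] carries one copy of the regular
    representation of [int * int], and the theorem says that a Riesz basis made
    of translates of generators has exactly as many generators as there are
    copies.  The proof stays at the level of inner products and finite sums.

    One generator gives a Riesz basis.  A frame has dense span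
    ([frame_dense]), and its upper bound is also an upper bound for synthesis
    ([synthesis_bound]).  For the lower bound, let [v] be a finite combination
    [sum_g b_g psi_g] and put [f = sum_g conj(b_g) phi_{-g}].  Orthonormality
    gives [|f|^2 = sum_g |b_g|^2], while [<f, psi_h>] is the conjugate of
    [<v, phi_{-h}>]; the lower frame bound at [f] followed by the Bessel
    inequality for [v] yields [A sum_g |b_g|^2 <= |v|^2]
    ([stationary_lower_synthesis_bound]).

    Two generators [psi1], [psi2] are one too many
    ([no_two_stationary_generators]).  Let [k_i(g) = <psi_i, phi_g>].  As
    convolution is commutative, [k2 * k1 - k1 * k2 = 0], which says that the
    combinations [v_F = sum_(g in F) (k2(g) psi1_g - k1(g) psi2_g)] tend to [0]
    weakly on the span of the [phi_h] when the finite set [F] grows.  The upper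
    Riesz bound makes them Cauchy, so by density they tend to [0] in norm; the
    lower Riesz bound then forces [k1 = 0], that is [psi1 = 0], which the same
    lower bound forbids.  No generator at all contradicts the lower frame bound.

    Density of the [phi_g] is the analytic part.  A bounded function is a
    multiplier when multiplication by it preserves the closed span.
    Multipliers form an algebra closed under bounded pointwise limits, by
    dominated convergence ([multiplier_lim]).  They include the [Lambda_m] and
    the cut-offs at the powers of [a]; polynomials in a trigonometric function
    converge boundedly to the indicator of a ray of the fundamental domain, so
    the indicator of every Borel set is a multiplier
    ([measurable_mult_set]), and dominated approximation by simple functions
    reaches all of [L^2]. *)

Set Implicit Arguments.
Unset Strict Implicit.
Unset Printing Implicit Defensive.

Import Order.TTheory GRing.Theory Num.Theory.
Import numFieldNormedType.Exports.
Import ComplexField.Normc.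
Local Open Scope classical_set_scope.
Local Open Scope ring_scope.

Local Notation Re := complex.Re.
Local Notation Im := complex.Im.

(** * Squared moduli of complex numbers *)

Section AbsoluteSquare.
Context {R : realType}.
Implicit Types z w : R[i].

Definition nsq z : R := normc z ^+ 2.

Lemma nsqE z : nsq z = Re z ^+ 2 + Im z ^+ 2.
Proof. by case: z => x y; rewrite /nsq sqr_sqrtr// addr_ge0// sqr_ge0. Qed.

Lemma normc_ge0 z : 0 <= normc z.
Proof. by case: z => x y; exact: sqrtr_ge0. Qed.

Lemma nsq_ge0 z : 0 <= nsq z.
Proof. exact: sqr_ge0. Qed.

Lemma nsq0 : nsq 0 = 0.
Proof. by rewrite nsqE /=; ring. Qed.

Lemma nsq1 : nsq 1 = 1.
Proof. by rewrite nsqE /=; ring. Qed.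

Lemma nsqM z w : nsq (z * w) = nsq z * nsq w.
Proof. by rewrite /nsq normcM exprMn. Qed.

Lemma nsqN z : nsq (- z) = nsq z.
Proof. by rewrite /nsq normcN. Qed.

Lemma nsqJ z : nsq z^*%C = nsq z.
Proof. by rewrite !nsqE; case: z => x y /=; ring. Qed.

Lemma nsqC (x : R) : nsq x%:C%C = x ^+ 2.
Proof. by rewrite nsqE /=; ring. Qed.

Lemma nsq_eq0 z : nsq z <= 0 -> z = 0.
Proof.
rewrite le_eqVlt ltNge nsq_ge0 orbF expf_eq0/= => /eqP; exact: eq0_normc.
Qed.

Lemma mul_conjc z : z * z^*%C = (nsq z)%:C%C.
Proof. by rewrite nsqE; case: z => x y; simpc; congr (_ +i* _)%C; ring. Qed.

Lemma Re_mul_conjc_le (t : R) z w : 0 < t ->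
  Re (z * w^*%C) <= (t * nsq z + t^-1 * nsq w) / 2.
Proof.
move=> t0; rewrite !nsqE; case: z w => x y [x' y'] /=.
have h (b b' : R) : b * b' <= (t * b ^+ 2 + t^-1 * b' ^+ 2) / 2.
  have : 0 <= t^-1 * (t * b - b') ^+ 2 by rewrite mulr_ge0 ?sqr_ge0// invr_ge0 ltW.
  have -> : t^-1 * (t * b - b') ^+ 2 = t * b ^+ 2 + t^-1 * b' ^+ 2 - 2 * (b * b').
    by field; rewrite gt_eqF.
  lra.
by have := h x x'; have := h y y'; lra.
Qed.

Lemma nsqD_le z w : nsq (z + w) <= 2 * (nsq z + nsq w).
Proof.
rewrite !nsqE; case: z w => x y [x' y'] /=.
by have := sqr_ge0 (x - x'); have := sqr_ge0 (y - y'); lra.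
Qed.

Lemma normcM_le z w : normc (z * w) <= (nsq z + nsq w) / 2.
Proof. by rewrite normcM /nsq; have := sqr_ge0 (normc z - normc w); lra. Qed.

Lemma normc_Re_le z : Re z <= normc z.
Proof.
apply: le_trans (ler_norm _) _; case: z => x y /=.
by rewrite -sqrtr_sqr ler_wsqrtr// lerDl sqr_ge0.
Qed.

Lemma normc_sum_le (I : Type) (r : seq I) (f : I -> R[i]) :
  normc (\sum_(i <- r) f i) <= \sum_(i <- r) normc (f i).
Proof.
elim/big_ind2 : _ => // [|z b w d zb wd]; first by rewrite normc0.
by apply: le_trans (le_normcD _ _) _; rewrite lerD.
Qed.

End AbsoluteSquare.

(** * Semi-inner products, spans and frames *)

(** The form is only semi-definite: square-integrable functions are not
    identified when they agree almost everywhere. *)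
Record semi_inner {R : realType} (V : lmodType R[i]) := SemiInner {
  ip :> V -> V -> R[i];
  ipDl : forall u v w, ip (u + v) w = ip u w + ip v w;
  ipZl : forall c u w, ip (c *: u) w = c * ip u w;
  ipC : forall u v, ip v u = (ip u v)^*%C;
  ip_ge0 : forall u, 0 <= Re (ip u u) }.

Section SemiInner.
Context {R : realType} {V : lmodType R[i]} (ip : semi_inner V).
Implicit Types (u v w : V) (c : R[i]).

Definition sqnorm u : R := Re (ip u u).
Local Notation q := sqnorm.

Lemma sqnorm_ge0 u : 0 <= q u. Proof. exact: ip_ge0. Qed.

Lemma ipuu u : ip u u = (q u)%:C%C.
Proof.
have := ipC ip u u; rewrite /q; case: (ip u u) => x y [] /= yN.
by congr (_ +i* _)%C; lra.
Qed.

Lemma ipDr u v w : ip u (v + w) = ip u v + ip u w.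
Proof. by rewrite ipC ipDl rmorphD/= -!ipC. Qed.

Lemma ipZr c u w : ip u (c *: w) = c^*%C * ip u w.
Proof. by rewrite ipC ipZl rmorphM/= -!ipC. Qed.

Lemma ip0l w : ip 0 w = 0.
Proof. by rewrite -(scale0r 0) ipZl mul0r. Qed.

Lemma ip0r w : ip w 0 = 0.
Proof. by rewrite ipC ip0l conjc0. Qed.

Lemma ipNl u w : ip (- u) w = - ip u w.
Proof. by rewrite -scaleN1r ipZl mulN1r. Qed.

Lemma ipNr u w : ip w (- u) = - ip w u.
Proof. by rewrite ipC ipNl rmorphN/= -ipC. Qed.

Lemma ip_suml (I : Type) (r : seq I) (f : I -> V) w :
  ip (\sum_(i <- r) f i) w = \sum_(i <- r) ip (f i) w.
Proof. by apply: (big_morph (ip ^~ w)) => [? ?|]; rewrite (ipDl, ip0l). Qed.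

Lemma ip_sumr (I : Type) (r : seq I) (f : I -> V) w :
  ip w (\sum_(i <- r) f i) = \sum_(i <- r) ip w (f i).
Proof. by apply: (big_morph (ip w)) => [? ?|]; rewrite (ipDr, ip0r). Qed.

Lemma sqnormD u v : q (u + v) = q u + 2 * Re (ip u v) + q v.
Proof.
rewrite /q ipDl !ipDr (ipC ip u v).
by case: (ip u u) (ip u v) (ip v v) => ? ? [? ?] [? ?] /=; ring.
Qed.

Lemma sqnormN u : q (- u) = q u.
Proof. by rewrite /q ipNl ipNr opprK. Qed.

Lemma sqnormB u v : q (u - v) = q u - 2 * Re (ip u v) + q v.
Proof. by rewrite sqnormD sqnormN ipNr raddfN/=; ring. Qed.

Lemma sqnormZ c u : q (c *: u) = nsq c * q u.
Proof.
rewrite {1}/q ipZl ipZr mulrA mul_conjc ipuu; simpc => /=.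
by [].
Qed.

Lemma sqnormD_le u v : q (u + v) <= 2 * (q u + q v).
Proof. by have := sqnorm_ge0 (u - v); rewrite sqnormB sqnormD; lra. Qed.

Lemma Re_ip_le u v : 2 * Re (ip u v) <= q u + q v.
Proof. by have := sqnorm_ge0 (u - v); rewrite sqnormB; lra. Qed.

Section Spans.
Context {I : choiceType} (e : I -> V).
Implicit Types (F : {fset I}) (b : I -> R[i]).

Definition lcomb F b : V := \sum_(i <- F) b i *: e i.

Definition in_span v := exists F b, v = lcomb F b.

Definition in_closure v :=
  forall eps : R, 0 < eps -> exists2 w, in_span w & q (v - w) < eps.

Lemma in_span_ind (P : V -> Prop) :
    P 0 -> (forall u v, P u -> P v -> P (u + v)) ->
    (forall c i, P (c *: e i)) ->
  forall v, in_span v -> P v.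
Proof. by move=> P0 PD Pe v [F [b ->]]; rewrite /lcomb; elim/big_ind : _. Qed.

Lemma lcomb_widen F F' b : (F `<=` F')%fset ->
  lcomb F b = lcomb F' (fun i => if i \in F then b i else 0).
Proof.
move=> FF'; rewrite /lcomb [RHS](big_fsetID _ (mem F))/= [X in _ = _ + X]big1_fset ?addr0.
  rewrite (_ : [fset _ | _ in _ & _]%fset = F); last first.
    apply/fsetP => i; rewrite !inE/= andbC.
    by case: (boolP (i \in F)) => // /(fsubsetP FF') ->.
  by apply: eq_big_seq => i ->.
by move=> i; rewrite !inE/= => /andP[_ /negbTE ->]; rewrite scale0r.
Qed.

Lemma in_span0 : in_span 0.
Proof. by exists fset0, (fun=> 0); rewrite /lcomb big_seq_fset0. Qed.

Lemma in_spanD u v : in_span u -> in_span v -> in_span (u + v).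
Proof.
move=> [F [b ->]] [F' [b' ->]].
rewrite (@lcomb_widen F (F `|` F')%fset) ?fsubsetUl//.
rewrite (@lcomb_widen F' (F `|` F')%fset) ?fsubsetUr//.
rewrite /lcomb -big_split/=; eexists _, (fun i => _ + _); apply: eq_bigr => i _.
by rewrite -scalerDl; reflexivity.
Qed.

Lemma in_spanZ c v : in_span v -> in_span (c *: v).
Proof.
move=> [F [b ->]]; exists F, (fun i => c * b i).
by rewrite /lcomb scaler_sumr; apply: eq_bigr => i _; rewrite scalerA.
Qed.

Lemma in_span_gen i : in_span (e i).
Proof. by exists [fset i]%fset, (fun=> 1); rewrite /lcomb big_seq_fset1 scale1r. Qed.

Lemma in_closureD u v : in_closure u -> in_closure v -> in_closure (u + v).
Proof.
move=> hu hv eps e0; have e4 : 0 < eps / 4 by lra.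
have [w sw uw] := hu _ e4; have [w' sw' vw'] := hv _ e4.
exists (w + w'); first exact: in_spanD.
rewrite opprD addrACA; have := sqnormD_le (u - w) (v - w'); lra.
Qed.

Lemma in_closureZ c v : in_closure v -> in_closure (c *: v).
Proof.
move=> hv eps e0; have n0 := nsq_ge0 c.
have [|w sw vw] := hv (eps / (nsq c + 1)); first by rewrite divr_gt0//; lra.
exists (c *: w); first exact: in_spanZ.
rewrite -scalerBr sqnormZ; move: vw; rewrite ltr_pdivlMr; last by lra.
by have := sqnorm_ge0 (v - w); nra.
Qed.

Lemma in_closure_closed v :
  (forall eps : R, 0 < eps -> exists2 w, in_closure w & q (v - w) < eps) ->
  in_closure v.
Proof.
move=> hv eps e0; have e4 : 0 < eps / 4 by lra.
have [w cw vw] := hv _ e4; have [w' sw' ww'] := cw _ e4.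
exists w' => //; have := sqnormD_le (v - w) (w - w').
by rewrite addrA subrK; lra.
Qed.

End Spans.

Section BesselFrames.
Context {I : choiceType} (e : I -> V).
Implicit Types (F : {fset I}) (b : I -> R[i]).

Definition orthonormal := forall i j, ip (e i) (e j) = (i == j)%:R.

(** The frame inequalities, with the infinite sums expressed through their
    finite partial sums. *)
Definition upper_frame_bound (B : R) := forall f F,
  \sum_(i <- F) nsq (ip f (e i)) <= B * q f.

Definition lower_frame_bound (A : R) := forall f s,
  (forall F, \sum_(i <- F) nsq (ip f (e i)) <= s) -> A * q f <= s.

Lemma sqnorm_orthonormal F b : orthonormal ->
  q (lcomb e F b) = \sum_(i <- F) nsq (b i).
Proof.
move=> oe; rewrite /q /lcomb ip_suml raddf_sum/=; apply: eq_big_seq => i iF.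
rewrite ipZl ip_sumr (big_fsetD1 i)//= big1_fset ?addr0.
  by rewrite ipZr oe eqxx mulr1 mul_conjc.
by move=> j; rewrite !inE => /andP[/negbTE ji _] _; rewrite ipZr oe eq_sym ji mulr0.
Qed.

Lemma Re_ip_analysis f F :
  Re (ip f (lcomb e F (fun i => ip f (e i)))) = \sum_(i <- F) nsq (ip f (e i)).
Proof.
rewrite /lcomb ip_sumr raddf_sum; apply: eq_bigr => i _.
by rewrite ipZr mulrC mul_conjc.
Qed.

Lemma bessel_inequality : orthonormal -> upper_frame_bound 1.
Proof.
move=> oe f F; rewrite mul1r.
have := sqnorm_ge0 (f - lcomb e F (fun i => ip f (e i))).
by rewrite sqnormB Re_ip_analysis sqnorm_orthonormal//; lra.
Qed.

(** With [v = lcomb F b], expand [|v|^2] as [sum_i b_i conj(<v, e_i>)] and apply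
    [2 x y <= B x^2 + y^2 / B] to each term; the analysis bound absorbs half
    of [|v|^2]. *)
Lemma synthesis_bound B : 0 < B -> upper_frame_bound B ->
  forall F b, q (lcomb e F b) <= B * \sum_(i <- F) nsq (b i).
Proof.
move=> B0 hB F b; set v := lcomb e F b.
have : q v <= \sum_(i <- F) (B * nsq (b i) + B^-1 * nsq (ip v (e i))) / 2.
  rewrite {1}/q {1}/v /lcomb ip_suml raddf_sum; apply: ler_sum => i _ /=.
  by rewrite ipZl (ipC ip v) Re_mul_conjc_le.
rewrite -mulr_suml big_split/= -!mulr_sumr; have := hB v F.
rewrite -ler_pdivrMl//; lra.
Qed.

(** The squared distance [d] of [f] to the span vanishes because one gradient
    step strictly improves any approximation.  If [h = f - w] is a current error
    and [s] a partial frame sum of [h], then subtracting [1/B] times the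
    corresponding synthesis of [h] lowers [|h|^2] by at least [s / B]; hence
    [d <= |h|^2 - s / B] and [A |h|^2 <= B (|h|^2 - d)].  Minimising over [h]
    gives [A d <= 0]. *)
Lemma frame_dense A B : 0 < A -> 0 < B -> lower_frame_bound A ->
  upper_frame_bound B -> forall f, in_closure e f.
Proof.
move=> A0 B0 hA hB f.
pose S : set R := [set t | exists2 w, in_span e w & t = q (f - w)]%classic.
have S0 : (S !=set0)%classic by exists (q (f - 0)), 0 => //; exact: in_span0.
have lbS : lbound S 0 by move=> _ [w _ ->]; exact: sqnorm_ge0.
have iS : has_inf S by split=> //; exists 0.
have infS w : in_span e w -> inf S <= q (f - w).
  by move=> sw; apply: ge_inf; [exists 0 | exists w].
have inf0 : 0 <= inf S by apply: lb_le_inf.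
suff infS0 : inf S <= 0.
  move=> eps e0; have [_ [w sw ->] fw] := inf_adherent e0 iS.
  by exists w => //; lra.
have step w : in_span e w -> A * q (f - w) <= B * (q (f - w) - inf S).
  move=> sw; apply: hA => F; set h := f - w.
  set s := \sum_(i <- F) _; set x := lcomb e F (fun i => ip h (e i)).
  have : inf S <= q (f - (w + (B^-1)%:C%C *: x)).
    by apply: infS; apply: in_spanD => //; apply: in_spanZ; exists F, (fun i => ip h (e i)).
  rewrite opprD addrA -/h sqnormB sqnormZ nsqC ipZr conjc_real.
  have -> : Re ((B^-1)%:C%C * ip h x) = B^-1 * s.
    by rewrite /s -Re_ip_analysis -/x; case: (ip h x) => ? ?; simpc.
  have := synthesis_bound B0 hB F (fun i => ip h (e i)); rewrite -/x -/s => qx.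
  rewrite -ler_pdivrMl//.
  have : B^-1 ^+ 2 * q x <= B^-1 * s.
    by rewrite expr2 -mulrA ler_pM2l ?invr_gt0// mulrC ler_pdivrMr// mulrC.
  lra.
apply/ler_addgt0Pr => d d0.
have [_ [w sw ->] fw] := inf_adherent (divr_gt0 (mulr_gt0 A0 d0) B0) iS.
have := step _ sw; have := infS _ sw.
rewrite -ltrBlDl ltr_pdivlMr// in fw; nra.
Qed.

End BesselFrames.

End SemiInner.

(** * Families indexed by an abelian group *)

Lemma sum_fsetD (I : choiceType) (M : nmodType) (F0 F : {fset I}) (f : I -> M) :
  (F0 `<=` F)%fset ->
  \sum_(i <- F) f i = \sum_(i <- F0) f i + \sum_(i <- (F `\` F0)%fset) f i.
Proof.
move=> F0F; rewrite (big_fsetID _ (mem F0))/=; congr (_ + _).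
  apply: eq_fbigl => i; rewrite !inE/=.
  by case: (boolP (i \in F0)) => [/(fsubsetP F0F) ->|_]; rewrite ?andbF.
by apply: eq_fbigl => i; rewrite !inE/= andbC.
Qed.

Lemma fdisjointDX (I : choiceType) (F0 F : {fset I}) : [disjoint F `\` F0 & F0]%fset.
Proof. by apply/fdisjointP => i; rewrite inE => /andP[]. Qed.

Section StationaryFamilies.
Context {R : realType} {V : lmodType R[i]} (ip : semi_inner V).
Context {G : zmodType} (phi : G -> V).
Hypothesis phi_on : orthonormal ip phi.
Local Notation q := (sqnorm ip).

(** What remains, at the level of inner products, of [phi_g] and [psi_g] being
    the orbits of two vectors under one unitary representation of [G]. *)
Definition stationary (psi : G -> V) :=
  forall g h, ip (phi g) (psi h) = ip (phi 0) (psi (h - g)).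

(** Test the lower frame bound on [f = sum_g conj(b_g) phi_{-g}]: stationarity
    and commutativity of [G] give [<f, psi_h> = conj(<v, phi_{-h}>)] for
    [v = lcomb psi F b], so that the Bessel inequality bounds the frame sum of
    [f] by [|v|^2]. *)
Lemma stationary_lower_synthesis_bound (psi : G -> V) (A : R) :
  stationary psi -> lower_frame_bound ip psi A ->
  forall (F : {fset G}) b, A * \sum_(g <- F) nsq (b g) <= q (lcomb psi F b).
Proof.
move=> st hA F b; pose phiN g := phi (- g).
have phiN_on : orthonormal ip phiN by move=> g h; rewrite /phiN phi_on eqr_opp.
have -> : \sum_(g <- F) nsq (b g) = q (lcomb phiN F (fun g => (b g)^*%C)).
  by rewrite sqnorm_orthonormal//; apply: eq_bigr => g _; rewrite nsqJ.
apply: hA => F'; rewrite -[leRHS]mul1r.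
apply: le_trans (bessel_inequality phiN_on _ F').
apply: ler_sum => h _; rewrite le_eqVlt -nsqJ; apply/orP; left; apply/eqP; congr nsq.
rewrite /lcomb !ip_suml rmorph_sum; apply: eq_bigr => g _.
rewrite !ipZl rmorphM/= conjcK -ipC /phiN; congr (_ * _).
by rewrite ipC st [in RHS]ipC [in RHS]st opprK [in RHS]addrC opprK.
Qed.

Lemma small_tail (k : G -> R[i]) (M : R) :
  (forall F : {fset G}, \sum_(g <- F) nsq (k g) <= M) ->
  forall eps : R, 0 < eps -> exists F0 : {fset G}, forall F : {fset G},
    [disjoint F & F0]%fset -> \sum_(g <- F) nsq (k g) <= eps.
Proof.
move=> hM eps e0.
pose S : set R := [set t | exists F : {fset G}, t = \sum_(g <- F) nsq (k g)]%classic.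
have supS : has_sup S.
  by split; [exists (\sum_(g <- fset0) nsq (k g)), fset0 | exists M => _ [F ->]].
have [_ [F0 ->] hF0] := sup_adherent e0 supS.
exists F0 => F FF0.
have : \sum_(g <- (F0 `|` F)%fset) nsq (k g) <= sup S.
  by apply: ub_le_sup; [case: supS | exists (F0 `|` F)%fset].
rewrite (sum_fsetD _ (fsubsetUl F0 F)) fsetDUl fsetDv fset0U.
by move/fsetDidPl: FF0 => ->; lra.
Qed.

Section TwoGenerators.
Variables (psi1 psi2 : G -> V) (A B : R).
Hypotheses (st1 : stationary psi1) (st2 : stationary psi2).
Hypotheses (A0 : 0 < A) (B0 : 0 < B).
Hypothesis dense : forall v, in_closure ip phi v.
Hypothesis up1 : forall (F : {fset G}) b, q (lcomb psi1 F b) <= B * \sum_(g <- F) nsq (b g).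
Hypothesis up2 : forall (F : {fset G}) b, q (lcomb psi2 F b) <= B * \sum_(g <- F) nsq (b g).
Hypothesis low : forall (F : {fset G}) b1 b2,
  A * \sum_(g <- F) (nsq (b1 g) + nsq (b2 g)) <= q (lcomb psi1 F b1 - lcomb psi2 F b2).

Let k1 g := ip (psi1 0) (phi g).
Let k2 g := ip (psi2 0) (phi g).
Let v (F : {fset G}) := lcomb psi1 F k2 - lcomb psi2 F k1.

Let ip_psi1 g h : ip (psi1 g) (phi h) = k1 (h - g).
Proof. by rewrite /k1 !(ipC ip (phi _)) st1 [in RHS]st1 sub0r opprB. Qed.

Let ip_psi2 g h : ip (psi2 g) (phi h) = k2 (h - g).
Proof. by rewrite /k2 !(ipC ip (phi _)) st2 [in RHS]st2 sub0r opprB. Qed.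

Let ip_v F h : ip (v F) (phi h) =
  \sum_(g <- F) (k2 g * k1 (h - g) - k1 g * k2 (h - g)).
Proof.
rewrite /v ipDl ipNl /lcomb !ip_suml sumrB; congr (_ - _); apply: eq_bigr => g _.
  by rewrite ipZl ip_psi1.
by rewrite ipZl ip_psi2.
Qed.

Let vD F0 F : (F0 `<=` F)%fset -> v F = v F0 + v (F `\` F0)%fset.
Proof. by move=> F0F; rewrite /v /lcomb !(sum_fsetD _ F0F) opprD addrACA. Qed.

Let tail1 (eps : R) : 0 < eps -> exists F0 : {fset G}, forall F : {fset G},
  [disjoint F & F0]%fset -> \sum_(g <- F) nsq (k1 g) <= eps.
Proof. exact: (@small_tail k1 _ (bessel_inequality phi_on (psi1 0))). Qed.

Let tail2 (eps : R) : 0 < eps -> exists F0 : {fset G}, forall F : {fset G},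
  [disjoint F & F0]%fset -> \sum_(g <- F) nsq (k2 g) <= eps.
Proof. exact: (@small_tail k2 _ (bessel_inequality phi_on (psi2 0))). Qed.

Let tail (eps : R) : 0 < eps -> exists F0 : {fset G}, forall F : {fset G},
  [disjoint F & F0]%fset ->
  \sum_(g <- F) nsq (k1 g) <= eps /\ \sum_(g <- F) nsq (k2 g) <= eps.
Proof.
move=> e0; have [F1 h1] := tail1 e0; have [F2 h2] := tail2 e0.
by exists (F1 `|` F2)%fset => F; rewrite fdisjointXU => /andP[/h1 ? /h2 ?].
Qed.

(** On sets stable under [g |-> h - g] the two convolutions in [ip_v] cancel
    exactly. *)
Let reflect (h : G) (F : {fset G}) : {fset G} := [fset h - g | g in F]%fset.

Let sum_reflect (M : zmodType) h F (f : G -> M) :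
  \sum_(g <- reflect h F) f g = \sum_(g <- F) f (h - g).
Proof. by rewrite big_imfset//= => x y _ _ /addrI /oppr_inj. Qed.

Let in_reflect h F g : (g \in reflect h F) = (h - g \in F).
Proof.
rewrite -{1}(subKr h g) /reflect (@mem_imfset _ _ _ (fun x => h - x))//=.
by move=> x y /addrI /oppr_inj.
Qed.

(** The numbers [<v F, w>] tend to [0] as the finite set [F] grows. *)
Let vanishing w := forall eps : R, 0 < eps -> exists F0 : {fset G},
  forall F : {fset G}, (F0 `<=` F)%fset -> normc (ip (v F) w) <= eps.

(** Choose a finite [F0] outside which [k1] and [k2] are small and let [D] be its
    union with its reflection.  The part of [ip_v] over [D] is [0] by symmetry;
    over the complement of [D] both [g] and [h - g] avoid [F0]. *)
Let vanishing_phi h : vanishing (phi h).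
Proof.
move=> eps e0; have [|F0 hF0] := @tail (eps / 2); first lra.
pose D := (F0 `|` reflect h F0)%fset; exists D => F DF; rewrite ip_v.
rewrite (sum_fsetD _ DF) [X in X + _](_ : _ = 0) ?add0r; last first.
  have DE : reflect h D = D.
    by apply/fsetP => g; rewrite in_reflect !in_fsetU !in_reflect subKr orbC.
  rewrite sumrB -{2}DE sum_reflect -sumrB big1// => g _.
  by rewrite subKr mulrC subrr.
set E := (F `\` D)%fset.
have dE : [disjoint E & F0]%fset.
  apply/fdisjointP => g; rewrite !inE => /andP[/norP[? _] _] //.
have dE' : [disjoint reflect h E & F0]%fset.
  by apply/fdisjointP => g; rewrite in_reflect in_fsetD in_fsetU in_reflect subKr => /andP[/norP[]].
have [e1 e2] := hF0 _ dE; have [] := hF0 _ dE'; rewrite !sum_reflect => e3 e4.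
apply: le_trans (normc_sum_le _ _) _.
apply: (@le_trans _ _ (\sum_(g <- E) ((nsq (k2 g) + nsq (k1 (h - g))) / 2 +
                        (nsq (k1 g) + nsq (k2 (h - g))) / 2))).
  apply: ler_sum => g _; apply: le_trans (le_normcD _ _) _.
  by rewrite normcN lerD// normcM_le.
rewrite big_split/= -!mulr_suml !big_split/=; lra.
Qed.

Let vanishing_span w : in_span phi w -> vanishing w.
Proof.
apply: in_span_ind w => [|w w' hw hw'|c h] eps e0.
- by exists fset0 => F _; rewrite ip0r normc0 ltW.
- have e2 : 0 < eps / 2 by lra.
  have [F1 h1] := hw _ e2; have [F2 h2] := hw' _ e2.
  exists (F1 `|` F2)%fset => F; rewrite fsubUset => /andP[/h1 ? /h2 ?].
  rewrite ipDr; apply: le_trans (le_normcD _ _) _; lra.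
- have c1 : 0 < normc c + 1 by rewrite ltr_wpDl// normc_ge0.
  have [|F0 h0] := @vanishing_phi h (eps / (normc c + 1)); first exact: divr_gt0.
  exists F0 => F /h0; rewrite ler_pdivlMr// ipZr normcM => hF.
  have -> : normc c^*%C = normc c by case: (c) => x y /=; rewrite sqrrN.
  apply: le_trans hF; rewrite mulrC ler_wpM2l// ?normc_ge0//; lra.
Qed.

(** Past a finite [F0] the vectors [v F] stay close to [v F0] by the upper
    bounds, and [v F0] is close to some [w] in the span of [phi], against which
    [v F] tends to [0]. *)
Let sqnorm_v_small g0 (eps : R) : 0 < eps -> exists F : {fset G},
  g0 \in F /\ q (v F) <= (4 + 8 * B) * eps.
Proof.
move=> e0; have [F0 h0] := tail e0.
have [w sw vw] := dense (v F0) e0.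
have [F1 h1] := vanishing_span sw e0.
pose F := (g0 |` (F0 `|` F1))%fset; exists F; split; first by rewrite !inE eqxx.
have F1F : (F1 `<=` F)%fset by rewrite /F fsetUA fsubsetUr.
have F0F : (F0 `<=` F)%fset by rewrite /F fsetUCA fsubsetUl.
have {}h1 := h1 _ F1F.
have [t1 t2] := h0 (F `\` F0)%fset (fdisjointDX _ _).
have vF := vD F0F.
have hD : q (v (F `\` F0)%fset) <= 4 * B * eps.
  have := sqnormD_le ip (lcomb psi1 (F `\` F0)%fset k2) (- lcomb psi2 (F `\` F0)%fset k1).
  rewrite sqnormN => /le_trans; apply.
  have := up1 (F `\` F0)%fset k2; have := up2 (F `\` F0)%fset k1.
  have : B * \sum_(g <- (F `\` F0)%fset) nsq (k1 g) <= B * eps by rewrite ler_pM2l.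
  have : B * \sum_(g <- (F `\` F0)%fset) nsq (k2 g) <= B * eps by rewrite ler_pM2l.
  lra.
have hw : q (v F - w) <= 2 * (4 * B * eps + eps).
  rewrite vF addrAC; apply: le_trans (sqnormD_le _ _ _) _; lra.
(* [|v F|^2 <= 2 Re <v F, w> + |v F - w|^2] with [|v F - w|^2 <= 2 (4 B eps + eps)]. *)
have := Re_ip_le ip (v F) (v F - w).
rewrite ipDr ipuu ipNr raddfD/= raddfN/=.
have := normc_Re_le (ip (v F) w); lra.
Qed.

(** The lower bound makes both [k1] and [k2] vanish, so [psi1 0] is orthogonal to
    the dense span of [phi]; but the same bound keeps its norm positive. *)
Lemma no_two_stationary_generators : False.
Proof.
have k1_0 g0 : k1 g0 = 0.
  apply: nsq_eq0; apply/ler_addgt0Pr => eps e0; rewrite add0r.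
  have [|F [gF]] := @sqnorm_v_small g0 (A * eps / (4 + 8 * B)).
    have : 0 < 8 * B by rewrite mulr_gt0.
    by move=> ?; apply: divr_gt0; [exact: mulr_gt0 | lra].
  rewrite mulrC divfK; last by rewrite gt_eqF//; have : 0 < 8 * B by [rewrite mulr_gt0]; lra.
  move=> /(le_trans (low F k2 k1)); rewrite ler_pM2l//; apply: le_trans.
  rewrite (big_fsetD1 g0)//= addrAC lerDr.
  by rewrite addr_ge0 ?nsq_ge0// sumr_ge0// => g _; rewrite addr_ge0// nsq_ge0.
have q0 : q (psi1 0) <= 0.
  apply/ler_addgt0Pr => eps e0; rewrite add0r.
  have [w sw pw] := dense (psi1 0) e0.
  have ipw : ip (psi1 0) w = 0.
    move: w sw {pw}; apply: in_span_ind => [|u u' hu hu'|c h]; first exact: ip0r.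
      by rewrite ipDr hu hu' addr0.
    by rewrite ipZr -/(k1 h) k1_0 mulr0.
  have := Re_ip_le ip (psi1 0) (psi1 0 - w).
  by rewrite ipDr ipNr ipw subr0 ipuu/=; lra.
have := low [fset 0]%fset (fun=> 1) (fun=> 0).
rewrite /lcomb !big_seq_fset1 scale1r scale0r subr0 nsq1 nsq0 addr0 mulr1 => Aq.
by move: (le_trans Aq q0); rewrite leNgt A0.
Qed.

End TwoGenerators.
End StationaryFamilies.

(** * The space of square-integrable functions *)

Section CMeasurable.
Context {R : realType}.
Implicit Types f g : R -> R[i].
Local Notation mu := (@lebesgue_measure R).

Lemma measurable_Rplus : measurable (@Rplus R : set (measurableTypeR R)).
Proof. exact: measurable_itv. Qed.
Hint Resolve measurable_Rplus : core.

(** Measurability of a complex function on the half-line, through its real and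
    imaginary parts. *)
Definition cmeas f := measurable_fun (@Rplus R) (fun x => Re (f x)) /\
  measurable_fun (@Rplus R) (fun x => Im (f x)).

Lemma cmeasD f g : cmeas f -> cmeas g -> cmeas (fun x => f x + g x).
Proof.
move=> [rf mf] [rg mg]; split.
  by under eq_fun do rewrite raddfD; exact: measurable_funD.
by under eq_fun do rewrite raddfD; exact: measurable_funD.
Qed.

Lemma cmeasM f g : cmeas f -> cmeas g -> cmeas (fun x => f x * g x).
Proof.
have ReM (z w : R[i]) : Re (z * w) = Re z * Re w - Im z * Im w.
  by case: z w => ? ? [? ?].
have ImM (z w : R[i]) : Im (z * w) = Re z * Im w + Im z * Re w.
  by case: z w => ? ? [? ?].
move=> [rf mf] [rg mg]; split.
  by under eq_fun do rewrite ReM; apply: measurable_funB; exact: measurable_funM.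
by under eq_fun do rewrite ImM; apply: measurable_funD; exact: measurable_funM.
Qed.

Lemma cmeas_cst c : cmeas (fun=> c).
Proof. by split; exact: measurable_cst. Qed.

Lemma cmeasJ f : cmeas f -> cmeas (fun x => (f x)^*%C).
Proof.
move=> [rf mf]; split.
  by rewrite (_ : (fun x => _) = (fun x => Re (f x)))//; apply/funext => x; case: (f x).
rewrite (_ : (fun x => _) = (fun x => - Im (f x))); first exact: measurableT_comp.
by apply/funext => x; case: (f x).
Qed.

Lemma cmeas_nsq f : cmeas f -> measurable_fun (@Rplus R) (fun x => nsq (f x)).
Proof.
move=> [rf mf]; under eq_fun do rewrite nsqE.
by apply: measurable_funD; exact: measurable_funX.
Qed.

Lemma cmeas_real (h : R -> R) : measurable_fun (@Rplus R) h -> cmeas (fun x => (h x)%:C%C).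
Proof. by move=> mh; split => //=; exact: measurable_cst. Qed.

Lemma eq_cmeas f g : {in (@Rplus R), f =1 g} -> cmeas f -> cmeas g.
Proof.
move=> fg [rf mf]; split.
  by apply: eq_measurable_fun rf => x xR; rewrite fg.
by apply: eq_measurable_fun mf => x xR; rewrite fg.
Qed.

Definition cintegrable f :=
  mu.-integrable (@Rplus R) (fun x => (Re (f x))%:E) /\
  mu.-integrable (@Rplus R) (fun x => (Im (f x))%:E).

Lemma cintegrable_dominated f (b : R -> R) : cmeas f ->
  (forall x, Rplus x -> normc (f x) <= b x) ->
  mu.-integrable (@Rplus R) (EFin \o b) -> cintegrable f.
Proof.
move=> [rf mf] fb ib; split; apply: le_integrable ib => //.
- exact/measurable_EFinP.
- move=> x xR; rewrite /= lee_fin; apply: le_trans (le_trans (fb _ xR) (ler_norm _)).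
  by case: (f x) => u v /=; rewrite -sqrtr_sqr ler_wsqrtr// lerDl sqr_ge0.
- exact/measurable_EFinP.
- move=> x xR; rewrite /= lee_fin; apply: le_trans (le_trans (fb _ xR) (ler_norm _)).
  by case: (f x) => u v /=; rewrite -sqrtr_sqr ler_wsqrtr// lerDr sqr_ge0.
Qed.

Lemma cintegralD f g : cintegrable f -> cintegrable g ->
  cintegral (fun x => f x + g x) = cintegral f + cintegral g.
Proof.
move=> [rf mf] [rg mg]; rewrite /cintegral; congr (_ +i* _)%C.
  by rewrite -RintegralD//; apply: eq_Rintegral => x _; rewrite raddfD.
by rewrite -RintegralD//; apply: eq_Rintegral => x _; rewrite raddfD.
Qed.

Lemma cintegralZ c f : cintegrable f ->
  cintegral (fun x => c * f x) = c * cintegral f.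
Proof.
move=> [rf mf]; case: c => a b; rewrite /cintegral; simpc.
have iZ (k : R) (h : R -> R) : mu.-integrable (@Rplus R) (EFin \o h) ->
    mu.-integrable (@Rplus R) (EFin \o (fun x => k * h x)).
  move=> ih; rewrite (_ : _ \o _ = (fun x => k%:E * (h x)%:E)%E) //.
  exact: integrableZl.
congr (_ +i* _)%C.
  rewrite -!RintegralZl// -RintegralB//; [|exact: iZ..].
  by apply: eq_Rintegral => x _; case: (f x).
rewrite -!RintegralZl// -RintegralD//; [|exact: iZ..].
by apply: eq_Rintegral => x _; case: (f x).
Qed.

Lemma cintegralJ f : cintegrable f ->
  cintegral (fun x => (f x)^*%C) = (cintegral f)^*%C.
Proof.
move=> [rf mf]; rewrite /cintegral /=; congr (_ +i* _)%C.
  by apply: eq_Rintegral => x _; case: (f x).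
rewrite -mulN1r -RintegralZl//.
by apply: eq_Rintegral => x _; case: (f x) => ? ?; rewrite mulN1r.
Qed.

Lemma eq_cintegral f g : {in (@Rplus R), f =1 g} -> cintegral f = cintegral g.
Proof. by move=> fg; congr (_ +i* _)%C; apply: eq_Rintegral => x xR; rewrite fg. Qed.

Lemma L2_cmeas f : L2 f -> cmeas f.
Proof. by case. Qed.

Lemma L2_integrable f : L2 f -> mu.-integrable (@Rplus R) (fun x => (nsq (f x))%:E).
Proof.
move=> [rf mf fty]; apply/integrableP; split.
  by apply/measurable_EFinP; apply: cmeas_nsq.
by under eq_integral do rewrite /= (ger0_norm (nsq_ge0 _)).
Qed.

Lemma L2_dominated f (b : R -> R) : cmeas f ->
  (forall x, Rplus x -> nsq (f x) <= b x) ->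
  mu.-integrable (@Rplus R) (EFin \o b) -> L2 f.
Proof.
move=> mf fb ib; case: (mf) => r m; split => //.
have /integrableP[_] : mu.-integrable (@Rplus R) (fun x => (nsq (f x))%:E).
  apply: le_integrable ib => //; first by apply/measurable_EFinP; exact: cmeas_nsq.
  move=> x xR; rewrite /= lee_fin; apply: le_trans (le_trans (fb _ xR) (ler_norm _)).
  by rewrite ger0_norm ?nsq_ge0.
by under eq_integral do rewrite /= (ger0_norm (nsq_ge0 _)).
Qed.

Lemma L2_0 : L2 (0 : R -> R[i]).
Proof.
apply: (@L2_dominated _ (fun=> 0)); first exact: cmeas_cst.
- by move=> x _; rewrite nsq0.
- exact: integrable0.
Qed.

Lemma L2D f g : L2 f -> L2 g -> L2 (fun x => f x + g x).
Proof.
move=> hf hg; apply: (@L2_dominated _ (fun x => 2 * (nsq (f x) + nsq (g x)))).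
- by apply: cmeasD; exact: L2_cmeas.
- by move=> x _; exact: nsqD_le.
- have := @integrableZl _ _ _ mu _ measurable_Rplus 2 _
    (@integrableD _ _ _ mu _ measurable_Rplus _ _ (L2_integrable hf) (L2_integrable hg)).
  by apply: eq_integrable => // x _ /=; rewrite EFinM EFinD.
Qed.

Lemma L2M (h : R -> R[i]) (M : R) f : cmeas h ->
  (forall x, Rplus x -> nsq (h x) <= M) -> L2 f -> L2 (fun x => h x * f x).
Proof.
move=> mh hM hf; apply: (@L2_dominated _ (fun x => M * nsq (f x))).
- by apply: cmeasM => //; exact: L2_cmeas.
- by move=> x xR; rewrite nsqM ler_wpM2r ?nsq_ge0// hM.
- have := @integrableZl _ _ _ mu _ measurable_Rplus M _ (L2_integrable hf).
  by apply: eq_integrable => // x _ /=; rewrite EFinM.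
Qed.

Lemma L2Z c f : L2 f -> L2 (fun x => c * f x).
Proof. by apply: (@L2M (fun=> c) (nsq c)) => //; exact: cmeas_cst. Qed.

Lemma eq_L2 f g : {in (@Rplus R), f =1 g} -> L2 f -> L2 g.
Proof.
move=> fg hf; apply: (@L2_dominated _ (fun x => nsq (f x))).
- by apply: eq_cmeas fg _; exact: L2_cmeas.
- by move=> x xR; rewrite fg// inE.
- exact: L2_integrable.
Qed.

Lemma cintegrable_inner f g : L2 f -> L2 g -> cintegrable (fun x => f x * (g x)^*%C).
Proof.
move=> hf hg; apply: (@cintegrable_dominated _ (fun x => nsq (f x) + nsq (g x))).
- by apply: cmeasM; [|apply: cmeasJ]; exact: L2_cmeas.
- move=> x _; apply: le_trans (normcM_le _ _) _; rewrite nsqJ.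
  by have := nsq_ge0 (f x); have := nsq_ge0 (g x); lra.
- have := @integrableD _ _ _ mu _ measurable_Rplus _ _ (L2_integrable hf) (L2_integrable hg).
  by apply: eq_integrable => // x _ /=; rewrite EFinD.
Qed.

Lemma normL2sqE f : L2 f -> normL2sq f = (Re (innerL2 f f))%:E.
Proof.
move=> hf; rewrite /normL2sq /innerL2 /cintegral/= /Rintegral fineK.
  apply: eq_integral => x _; rewrite -/(nsq (f x)) mul_conjc//.
under eq_integral do rewrite mul_conjc/=.
exact/integrable_fin_num/L2_integrable.
Qed.

Lemma eq_normL2sq f g : {in (@Rplus R), f =1 g} -> normL2sq f = normL2sq g.
Proof. by move=> fg; apply: eq_integral => x xR; rewrite fg. Qed.

(** Square-integrable functions are packed into a type so that they form a
    module, to which the results on semi-inner products apply. *)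
Definition inL2 : {pred R -> R[i]} := fun f => `[< L2 f >].

Lemma inL2_submod : GRing.submod_closed inL2.
Proof.
split; first by apply/asboolP; exact: L2_0.
move=> c f g /asboolP hf /asboolP hg; apply/asboolP.
by apply: L2D => //; exact: L2Z.
Qed.

HB.instance Definition _ := GRing.isSubmodClosed.Build R[i] (R -> R[i]) inL2 inL2_submod.

Record L2space := L2Space { L2fun :> R -> R[i]; _ : L2fun \in inL2 }.
HB.instance Definition _ := [isSub for L2fun].
HB.instance Definition _ := [Choice of L2space by <:].
HB.instance Definition _ := [SubChoice_isSubLmodule of L2space by <:].

Lemma L2spaceP (f : L2space) : L2 f.
Proof. by case: f => f hf; exact/asboolP. Qed.

Lemma L2inP f : L2 f -> f \in inL2.
Proof. by move=> ?; apply/asboolP. Qed.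

Definition toL2 f (hf : L2 f) : L2space := L2Space (L2inP hf).

Definition ipL2 (f g : L2space) := innerL2 f g.

Lemma ipL2D (f g h : L2space) : ipL2 (f + g) h = ipL2 f h + ipL2 g h.
Proof.
rewrite /ipL2 /innerL2 -cintegralD.
- by apply: eq_cintegral => x _; rewrite /= mulrDl.
- by apply: cintegrable_inner; exact: L2spaceP.
- by apply: cintegrable_inner; exact: L2spaceP.
Qed.

Lemma ipL2Z c (f h : L2space) : ipL2 (c *: f) h = c * ipL2 f h.
Proof.
rewrite /ipL2 /innerL2 -cintegralZ.
  by apply: eq_cintegral => x _; rewrite /= mulrA.
by apply: cintegrable_inner; exact: L2spaceP.
Qed.

Lemma ipL2C (f g : L2space) : ipL2 g f = (ipL2 f g)^*%C.
Proof.
rewrite /ipL2 /innerL2 -cintegralJ.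
  by apply: eq_cintegral => x _; rewrite /= rmorphM/= conjcK mulrC.
by apply: cintegrable_inner; exact: L2spaceP.
Qed.

Lemma ipL2_ge0 (f : L2space) : 0 <= Re (ipL2 f f).
Proof.
apply: Rintegral_ge0 => x _; rewrite mul_conjc; exact: nsq_ge0.
Qed.

Definition L2ip := SemiInner ipL2D ipL2Z ipL2C ipL2_ge0.

Lemma normL2sq_sqnorm (f : L2space) : normL2sq f = (sqnorm L2ip f)%:E.
Proof. by rewrite normL2sqE//; exact: L2spaceP. Qed.

Lemma L2space_lincomb (I : choiceType) (e : I -> L2space) (F : {fset I}) b x :
  lcomb e F b x = lincomb (fun i => e i : R -> R[i]) F b x.
Proof.
by rewrite /lincomb /lcomb -[LHS]/(\val _ x) raddf_sum fct_sumE.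
Qed.

End CMeasurable.
#[global] Hint Resolve measurable_Rplus : core.

(** * Change of scale in integrals over the half-line *)

Section Scaling.
Context {R : realType}.
Local Notation mu := (@lebesgue_measure R).
Variable c : R.
Hypothesis c0 : 0 < c.

Definition scaling (c : R) (x : measurableTypeR R) : measurableTypeR R := c * x.

Lemma measurable_scaling k : measurable_fun setT (scaling k).
Proof. exact: measurable_funM. Qed.

Lemma scaling_itv (b b' : bool) (x y : R) :
  scaling c @^-1` [set` Interval (BSide b x) (BSide b' y)] =
  [set` Interval (BSide b (c^-1 * x)) (BSide b' (c^-1 * y))].
Proof.
apply/seteqP; split => z /=; rewrite !itv_boundlr /scaling;
 by case: b; case: b'; rewrite !bnd_simp ?ler_pdivrMl ?ltr_pdivrMl ?ler_pdivlMl ?ltr_pdivlMl.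
Qed.

(** Both sides are measures in [A] that agree on half-open intervals. *)
Lemma lebesgue_measure_scaling (A : set R) : measurable A ->
  (mu A = c%:E * mu (scaling c @^-1` A))%E.
Proof.
move=> mA.
pose nu : {measure set (measurableTypeR R) -> \bar R} :=
  mscale (NngNum (ltW c0)) (pushforward mu (scaling c)).
rewrite -[RHS]/(nu (measurable_scaling c) A).
apply: (@lebesgue_measure_unique _ (nu (measurable_scaling c))) => // _ [[x y]] _ <-.
rewrite /nu/= /mscale/= /pushforward/= scaling_itv !lebesgue_measure_itv/= !lte_fin.
rewrite ltr_pM2l ?invr_gt0//; case: ifPn => _; last by rewrite mule0.
by rewrite -!EFinB -EFinM -mulrBr mulrA divff ?gt_eqF// mul1r.
Qed.

Lemma ge0_integral_scaling (f : R -> \bar R) :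
  measurable_fun (@Rplus R) f -> (forall x, Rplus x -> (0 <= f x)%E) ->
  (\int[mu]_(x in Rplus) f x = c%:E * \int[mu]_(x in Rplus) f (c * x)%R)%E.
Proof.
move=> mf f0.
have pre : scaling c @^-1` Rplus = @Rplus R.
  by apply/seteqP; split => z; rewrite /Rplus/= !in_itv/= !andbT /scaling pmulr_rgt0.
pose nu : {measure set (measurableTypeR R) -> \bar R} :=
  mscale (NngNum (ltW c0)) (pushforward mu (scaling c)).
rewrite (@eq_measure_integral _ _ _ _ (nu (measurable_scaling c))) /nu.
  rewrite ge0_integral_mscale//=; last exact: measurable_Rplus.
  rewrite ge0_integral_pushforward//= ?pre//.
    exact: measurable_scaling.
    exact: measurable_Rplus.
  by move=> x; rewrite inE; exact: f0.
by move=> A mA _; exact: lebesgue_measure_scaling.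
Qed.

Lemma Rintegral_scaling (f : R -> R) :
  mu.-integrable (@Rplus R) (EFin \o f) ->
  \int[mu]_(x in Rplus) f x = c * \int[mu]_(x in Rplus) f (c * x).
Proof.
move=> fi; have mf := measurable_int mu fi.
have mp : measurable_fun (@Rplus R) ((EFin \o f)^\+)%E by exact: measurable_funepos.
have mn : measurable_fun (@Rplus R) ((EFin \o f)^\-)%E by exact: measurable_funeneg.
have fp := integrable_fin_num (@measurable_Rplus R) (integrable_funepos (@measurable_Rplus R) fi).
have fn := integrable_fin_num (@measurable_Rplus R) (integrable_funeneg (@measurable_Rplus R) fi).
have fin_scale (x : \bar R) : (c%:E * x)%E \is a fin_num -> x \is a fin_num.
  by case: x => //; rewrite ?gt0_muley ?gt0_muleNy ?lte_fin.
have Ep := ge0_integral_scaling mp (fun x _ => funepos_ge0 (EFin \o f) x).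
have En := ge0_integral_scaling mn (fun x _ => funeneg_ge0 (EFin \o f) x).
have {}fp : (\int[mu]_(x in Rplus) ((EFin \o f)^\+ (c * x)%R))%E \is a fin_num.
  by apply: fin_scale; rewrite -Ep.
have {}fn : (\int[mu]_(x in Rplus) ((EFin \o f)^\- (c * x)%R))%E \is a fin_num.
  by apply: fin_scale; rewrite -En.
transitivity (fine (c%:E * (\int[mu]_(x in Rplus) ((EFin \o f)^\+ (c * x)%R) -
                           \int[mu]_(x in Rplus) ((EFin \o f)^\- (c * x)%R)))%E).
  congr fine; rewrite integralE muleBr //; last exact: fin_num_adde_defr.
  by congr (_ - _)%E; [exact: Ep | exact: En].
transitivity (c * fine (\int[mu]_(x in Rplus) ((EFin \o f)^\+ (c * x)%R) -
                        \int[mu]_(x in Rplus) ((EFin \o f)^\- (c * x)%R))%E)%R.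
  by case: (integral _ _ _) fp => // ? _; case: (integral _ _ _) fn.
rewrite [in RHS]/Rintegral [in RHS]integralE.
by congr (_ * fine (_ - _)%E); apply: eq_integral => x _; rewrite ?funeposE ?funenegE.
Qed.

End Scaling.

(** * Correlations of the atoms of the system *)

Section Expi.
Context {R : realType}.
Implicit Types x y : R.

Lemma conjcM (z w : R[i]) : (z * w)^*%C = z^*%C * w^*%C.
Proof. exact: rmorphM. Qed.

Lemma real_complexM x y : (x * y)%:C%C = x%:C%C * y%:C%C :> R[i].
Proof. exact: rmorphM. Qed.

Lemma expiD x y : expi (x + y) = expi x * expi y.
Proof. by rewrite /expi sinD cosD; simpc; congr (_ +i* _)%C; ring. Qed.

Lemma expiN x : expi (- x) = (expi x)^*%C.
Proof. by rewrite /expi sinN cosN. Qed.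

Lemma expi0 : expi (0 : R) = 1.
Proof. by rewrite /expi sin0 cos0. Qed.

Lemma nsq_expi x : nsq (expi x) = 1.
Proof. by rewrite nsqE /= cos2Dsin2. Qed.

End Expi.

Section Atoms.
Context {R : realType} (a : R).
Hypothesis a1 : 1 < a.
Local Notation mu := (@lebesgue_measure R).
Implicit Types (m n j k : int) (f u v : R -> R[i]) (x y : R).

Let a0 : 0 < a. Proof. exact: lt_trans a1. Qed.
Let lna : 0 < ln a. Proof. by rewrite ln_gt0. Qed.

Lemma exprz_gt0a j : 0 < a ^ j. Proof. exact: exprz_gt0. Qed.
Hint Resolve exprz_gt0a : core.

Lemma dilexp_scale j x : 0 < x -> dilexp a (a ^ j * x) = j + dilexp a x.
Proof.
move=> x0; rewrite /dilexp lnM ?posrE// -powR_intmul ?(ltW a0)// ln_powR.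
by rewrite mulrDl mulfK ?gt_eqF// floorDzr ?intrKfloor//; exact: intr_int.
Qed.

(** The representative of [x] modulo dilations by [a] in the fundamental domain
    [[1, a)]. *)
Definition theta x := x / a ^ dilexp a x.

Lemma theta_scale j x : 0 < x -> theta (a ^ j * x) = theta x.
Proof.
move=> x0; rewrite /theta dilexp_scale// expfzDr ?gt_eqF//.
by rewrite -mulf_div divff ?mul1r// gt_eqF.
Qed.

Lemma dilexp_itv x : 0 < x -> a ^ dilexp a x <= x < a ^ (dilexp a x + 1).
Proof.
move=> x0; have /andP[h1 h2] := floor_itv (ln x / ln a).
rewrite -!powR_intmul ?(ltW a0)//.
rewrite -ler_ln ?posrE ?powR_gt0// -ltr_ln ?posrE ?powR_gt0// !ln_powR.
by rewrite -ler_pdivlMr// -ltr_pdivrMr// h1 h2.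
Qed.

Lemma theta_itv x : 0 < x -> 1 <= theta x < a.
Proof.
move=> /dilexp_itv; rewrite expfzDr ?gt_eqF// expr1z mulrC.
by rewrite /theta ler_pdivlMr// mul1r ltr_pdivrMr.
Qed.

Lemma dilexp_eq0 x : 1 <= x < a -> dilexp a x = 0.
Proof.
move=> /andP[x1 xa]; have x0 : 0 < x by apply: lt_le_trans x1.
apply: floor_def; rewrite mulr0z add0r mulr1z.
apply/andP; split; first by rewrite divr_ge0 ?ln_ge0// ltW.
by rewrite ltr_pdivrMr// mul1r ltr_ln ?posrE// (lt_trans x0 xa).
Qed.

Lemma theta_id x : 1 <= x < a -> theta x = x.
Proof. by move=> /dilexp_eq0; rewrite /theta => ->; rewrite expr0z divr1. Qed.

Lemma measurable_dilexp : measurable_fun setT (fun x => (dilexp a x)%:~R : R).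
Proof.
apply: (@measurableT_comp _ _ _ _ _ _ (fun y : R => (Num.floor y)%:~R : R) _
  (fun x => ln x / ln a)).
  by apply: nondecreasing_measurable => // x y xy; rewrite ler_int le_floor.
by apply: measurable_funM => //; exact: measurable_ln.
Qed.

Lemma measurable_theta : measurable_fun setT theta.
Proof.
have -> : theta = (fun x => x * expR (- ln a * (dilexp a x)%:~R)).
  apply/funext => x; rewrite /theta; congr (_ * _).
  by rewrite -powR_intmul ?(ltW a0)// /powR gt_eqF// -expRN mulNr mulrC.
apply: measurable_funM => //; apply: measurableT_comp => //.
by apply: measurable_funM => //; exact: measurable_dilexp.
Qed.

Lemma LambdaE m x : Lambda a m x =
  ((Num.sqrt (a - 1))^-1)%:C%C * expi (2 * pi * m%:~R * theta x / (a - 1)).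
Proof. by []. Qed.

Lemma Lambda_scale m j x : 0 < x -> Lambda a m (a ^ j * x) = Lambda a m x.
Proof. by move=> x0; rewrite !LambdaE theta_scale. Qed.

Lemma sqrta1 : (Num.sqrt (a - 1))^-1 ^+ 2 = (a - 1)^-1.
Proof. by rewrite exprVn sqr_sqrtr// subr_ge0 ltW. Qed.

Lemma nsq_Lambda m x : nsq (Lambda a m x) = (a - 1)^-1.
Proof. by rewrite LambdaE nsqM nsqC nsq_expi mulr1 sqrta1. Qed.

Lemma LambdaMJ m n x : Lambda a m x * (Lambda a n x)^*%C =
  ((a - 1)^-1)%:C%C * expi (2 * pi * (m - n)%:~R * theta x / (a - 1)).
Proof.
rewrite !LambdaE conjcM conjc_real mulrACA -real_complexM -expr2 sqrta1 -expiN -expiD.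
congr (_ * expi _); rewrite -mulrBl; congr (_ / _).
by rewrite -mulrBl -mulrBr rmorphB.
Qed.

Lemma LambdaM m n x : Lambda a m x * Lambda a n x =
  ((Num.sqrt (a - 1))^-1)%:C%C * Lambda a (m + n) x.
Proof.
rewrite !LambdaE mulrACA -expiD -mulrA; congr (_ * (_ * expi _)).
rewrite -mulrDl; congr (_ / _); by rewrite -mulrDl -mulrDr rmorphD.
Qed.

Lemma measurable_Rplus_theta (h : R -> R) : continuous h ->
  measurable_fun (@Rplus R) (fun x => h (theta x)).
Proof.
move=> ch; apply: measurable_funTS; apply: measurableT_comp; last exact: measurable_theta.
exact: continuous_measurable_fun.
Qed.

Lemma cmeas_Lambda m : cmeas (Lambda a m).
Proof.
apply: cmeasM; first exact: cmeas_cst.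
split.
- apply: (@measurable_Rplus_theta (fun t => cos (2 * pi * m%:~R * t / (a - 1)))) => t.
  apply: (@continuous_comp _ _ _ (fun t => 2 * pi * m%:~R * t / (a - 1)));
    last exact: continuous_cos.
  by apply: cvgM; [apply: cvgM; [exact: cvg_cst|exact: cvg_id]|exact: cvg_cst].
- apply: (@measurable_Rplus_theta (fun t => sin (2 * pi * m%:~R * t / (a - 1)))) => t.
  apply: (@continuous_comp _ _ _ (fun t => 2 * pi * m%:~R * t / (a - 1)));
    last exact: continuous_sin.
  by apply: cvgM; [apply: cvgM; [exact: cvg_cst|exact: cvg_id]|exact: cvg_cst].
Qed.

Lemma cmeas_scaling c f : 0 < c -> cmeas f -> cmeas (fun x => f (c * x)).
Proof.
move=> c0 [rf mf].
have im : (scaling c @` Rplus `<=` @Rplus R).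
  by move=> _ [y + <-]; rewrite /Rplus/scaling/= !in_itv/= !andbT => ?; rewrite mulr_gt0.
have ms : measurable_fun (@Rplus R) (scaling c).
  by apply: measurable_funTS; exact: measurable_scaling.
by split; [exact: (measurable_comp _ im rf ms)|exact: (measurable_comp _ im mf ms)].
Qed.

Lemma L2_scaling c f : 0 < c -> L2 f -> L2 (fun x => f (c * x)).
Proof.
move=> c0 hf; have [r m] : cmeas (fun x => f (c * x)).
  by apply: cmeas_scaling => //; exact: L2_cmeas.
case: (hf) => _ _ fty; split => //; move: fty; rewrite /normL2sq (ge0_integral_scaling c0).
- by case: (integral _ _ _) => [r0||]; rewrite ?ltry ?ltNyr ?gt0_muley ?lte_fin.
- by apply/measurable_EFinP; apply: cmeas_nsq; exact: L2_cmeas.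
- by move=> x _; rewrite lee_fin sqr_ge0.
Qed.

Lemma cintegral_scaling c f : 0 < c -> cintegrable f ->
  cintegral f = c%:C%C * cintegral (fun x => f (c * x)).
Proof.
move=> c0 [rf mf]; rewrite /cintegral; simpc; congr (_ +i* _)%C.
  exact: Rintegral_scaling.
exact: Rintegral_scaling.
Qed.

Definition atom f (g : int * int) x := Lambda a g.1 x * dil (a ^ g.2) f x.

Lemma L2_atom f g : L2 f -> L2 (atom f g).
Proof.
move=> hf; apply: (@L2M _ _ ((a - 1)^-1)); first exact: cmeas_Lambda.
  by move=> x _; rewrite nsq_Lambda.
by apply: L2Z; exact: L2_scaling.
Qed.

(** The rescaling [x |-> a ^ j * x], with [g = (m, j)], preserves every
    [Lambda], and the Jacobian is absorbed by the normalisations of the two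
    dilations; the product [Lambda_m conj(Lambda_n)] only involves [m - n]. *)
Lemma inner_atom u v g h : L2 u -> L2 v ->
  innerL2 (atom u g) (atom v h) = innerL2 (atom u 0) (atom v (h - g)).
Proof.
move=> hu hv; case: g h => m j [n k].
have c0 := exprz_gt0a j.
have hi := cintegrable_inner (L2_atom 0 hu) (L2_atom ((n, k) - (m, j)) hv).
rewrite [RHS](cintegral_scaling c0 hi) -cintegralZ; last first.
  have := cintegrable_inner (L2_scaling c0 (L2_atom 0 hu))
    (L2_scaling c0 (L2_atom ((n, k) - (m, j)) hv)).
  exact.
apply: eq_cintegral => x; rewrite inE /Rplus/= in_itv/= andbT => x0.
rewrite /atom /= !Lambda_scale// /dil.
rewrite !(conjcM (Lambda _ _ _)) !(conjcM (Num.sqrt _)%:C%C) !conjc_real.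
rewrite [LHS](_ : _ = (Lambda a m x * (Lambda a n x)^*%C) *
  ((Num.sqrt (a ^ j))%:C%C * (Num.sqrt (a ^ k))%:C%C) *
    (u (a ^ j * x) * (v (a ^ k * x))^*%C)); last by ring.
rewrite [RHS](_ : _ = (Lambda a 0 x * (Lambda a (n - m) x)^*%C) *
  ((a ^ j)%:C%C * ((Num.sqrt (a ^ 0))%:C%C * (Num.sqrt (a ^ (k - j)))%:C%C)) *
    (u (a ^ 0 * (a ^ j * x)) * (v (a ^ (k - j) * (a ^ j * x)))^*%C)); last by ring.
rewrite expr0z sqrtr1 !mul1r (mulrA (a ^ (k - j))) -expfzDr ?gt_eqF// subrK; congr (_ * _ * _).
  by rewrite !LambdaMJ sub0r opprB.
rewrite -!real_complexM; congr (_%:C%C).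
rewrite -[X in X * Num.sqrt (_ ^ (k - j))]sqr_sqrtr ?(ltW c0)// expr2 -mulrA; congr (_ * _).
by rewrite -sqrtrM ?(ltW c0)// -expfzDr ?gt_eqF// addrC subrK.
Qed.

End Atoms.

(** * An orthonormal system of atoms *)

Section Orthonormal.
Context {R : realType} (a : R).
Hypothesis a1 : 1 < a.
Local Notation mu := (@lebesgue_measure R).
Implicit Types (m n j k : int) (x y w : R).

Lemma integral_derivative (f F : R -> R) x y : x < y ->
  (forall t : R, is_derive t (1 : R) F (f t)) -> continuous f ->
  \int[mu]_(t in `[x, y]) f t = F y - F x.
Proof.
move=> xy dF cf.
have dd (t : R) : derivable F t (1 : R) by case: (dF t).
have cF (t : R) : {for t, continuous F}.
  by apply: differentiable_continuous; exact/derivable1_diffP.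
rewrite /Rintegral (@continuous_FTC2 _ f F)//.
- exact: continuous_subspaceT.
- split=> [t _||]; first exact: dd.
  + exact: cvg_at_right_filter (cF x).
  + exact: cvg_at_left_filter (cF y).
- by move=> t _; rewrite derive1E derive_val.
Qed.

Lemma is_derive_sin_linear w x : is_derive x 1 (fun t => sin (w * t)) (w * cos (w * x)).
Proof.
by apply: is_derive_eq; rewrite /GRing.scale/=; ring.
Qed.

Lemma is_derive_cos_linear w x : is_derive x 1 (fun t => cos (w * t)) (- (w * sin (w * x))).
Proof.
by apply: is_derive_eq; rewrite /GRing.scale/=; ring.
Qed.

Lemma continuous_sin_linear w : continuous (fun t => sin (w * t)).
Proof.
move=> t; apply: (@continuous_comp _ _ _ (fun t => w * t)); last exact: continuous_sin.
by apply: cvgM; [exact: cvg_cst|exact: cvg_id].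
Qed.

Lemma continuous_cos_linear w : continuous (fun t => cos (w * t)).
Proof.
move=> t; apply: (@continuous_comp _ _ _ (fun t => w * t)); last exact: continuous_cos.
by apply: cvgM; [exact: cvg_cst|exact: cvg_id].
Qed.

Lemma sinD2piz n x : sin (x + 2 * pi * n%:~R) = sin x.
Proof.
have h (k : nat) y : sin (y + 2 * pi * k%:R) = sin y.
  rewrite -(periodicn (@sinD2pi R) k y); congr (sin (_ + _)).
  by rewrite -[RHS]mulr_natr -[pi *+ 2]mulr_natl.
case: n => k; first exact: h.
by rewrite NegzE rmorphN mulrN -[LHS](h k.+1) subrK.
Qed.

Lemma cosD2piz n x : cos (x + 2 * pi * n%:~R) = cos x.
Proof.
have h (k : nat) y : cos (y + 2 * pi * k%:R) = cos y.
  rewrite -(periodicn (@cosD2pi R) k y); congr (cos (_ + _)).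
  by rewrite -[RHS]mulr_natr -[pi *+ 2]mulr_natl.
case: n => k; first exact: h.
by rewrite NegzE rmorphN mulrN -[LHS](h k.+1) subrK.
Qed.

Let freq n : R := 2 * pi * n%:~R / (a - 1).

Let freq_a n : freq n * a = freq n * 1 + 2 * pi * n%:~R.
Proof. by rewrite /freq; field; rewrite subr_eq0 gt_eqF. Qed.

Let freq_neq0 n : n != 0 -> freq n != 0.
Proof.
move=> n0; rewrite /freq !mulf_neq0 ?invr_neq0 ?intr_eq0 ?subr_eq0 ?(gt_eqF a1)//.
by rewrite gt_eqF// pi_gt0.
Qed.

Lemma integral_cos_full_period n : n != 0 ->
  \int[mu]_(x in `[1, a]) cos (freq n * x) = 0.
Proof.
move=> n0; have w0 := freq_neq0 n0.
have dF (t : R) : is_derive t (1 : R)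
    (fun t => (freq n)^-1 * sin (freq n * t)) (cos (freq n * t)).
  have := is_derive_sin_linear (freq n) t => dF.
  by apply: is_derive_eq; rewrite /GRing.scale/=; field.
rewrite (integral_derivative a1 dF); first by rewrite freq_a sinD2piz subrr.
exact: continuous_cos_linear.
Qed.

Lemma integral_sin_full_period n : n != 0 ->
  \int[mu]_(x in `[1, a]) sin (freq n * x) = 0.
Proof.
move=> n0; have w0 := freq_neq0 n0.
have dF (t : R) : is_derive t (1 : R)
    (fun t => - (freq n)^-1 * cos (freq n * t)) (sin (freq n * t)).
  have := is_derive_cos_linear (freq n) t => dF.
  by apply: is_derive_eq; rewrite /GRing.scale/=; field.
rewrite (integral_derivative a1 dF); first by rewrite freq_a cosD2piz subrr.
exact: continuous_sin_linear.
Qed.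

Definition box x : R[i] := (1 <= x < a)%R%:R.

Let I1a : set R := `[1, a[%classic.

Let in_I1a x : (x \in I1a) = (1 <= x < a).
Proof. by rewrite /I1a mem_setE in_itv. Qed.

Lemma nsq_box x : nsq (box x) = \1_I1a x.
Proof.
by rewrite /box indicE in_I1a; case: (_ <= _ < _); rewrite ?nsq1 ?nsq0.
Qed.

Lemma cmeas_box : cmeas box.
Proof.
have -> : box = (fun x => (\1_I1a x : R)%:C%C).
  by apply/funext => x; rewrite /box indicE in_I1a; case: (_ <= _ < _).
by apply: cmeas_real; apply: measurable_indic; exact: measurable_itv.
Qed.

Lemma L2_box : L2 box.
Proof.
apply: (@L2_dominated _ _ (fun x => \1_I1a x)); first exact: cmeas_box.
  by move=> x _; rewrite nsq_box.
apply: (integrableS measurableT measurable_Rplus) => //.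
exact: (@integrable_indic_itv _ 1 a true true).
Qed.

Lemma Rintegral_box (h : R -> R) : continuous h ->
  \int[mu]_(x in Rplus) (if 1 <= x < a then h x else 0) = \int[mu]_(x in `[1, a]) h x.
Proof.
move=> ch; rewrite -Rintegral_itv_bndo_bndc; last first.
  apply: (@integrableS _ _ _ mu `[1, a]%classic) => //; first exact: subset_itv_co_cc.
  apply: continuous_compact_integrable; first exact: segment_compact.
  exact: continuous_subspaceT.
rewrite Rintegral_mkcond [RHS]Rintegral_mkcond; congr Rintegral.
apply/funext => x; rewrite !patchE mem_setE /Rplus mem_setE !in_itv/= andbT.
case: (ltP 0 x) => // x0; case: ifP => // /andP[x1 _].
by have := lt_le_trans ltr01 (le_trans x1 x0); rewrite ltxx.
Qed.


(** The integrals of [cos] and [sin] over a whole number of periods vanish. *)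
Lemma inner_atom_box_same n :
  innerL2 (atom a box 0) (atom a box (n, 0)) = (n == 0)%:R.
Proof.
have E : {in (@Rplus R), (fun x => atom a box 0 x * (atom a box (n, 0) x)^*%C) =1
  (fun x => (if 1 <= x < a then (a - 1)^-1 * cos (freq (- n) * x) else 0) +i*
            (if 1 <= x < a then (a - 1)^-1 * sin (freq (- n) * x) else 0))%C}.
  move=> x _; rewrite /atom /dil /= !expr0z sqrtr1 !mul1r /box.
  case: ifP => x1a; last by rewrite mulr0 mul0r.
  rewrite !mulr1 LambdaMJ// theta_id// sub0r /freq.
  by rewrite /expi; simpc; congr (_ * cos _ +i* (_ * sin _))%C; ring.
rewrite /innerL2 (eq_cintegral E) /cintegral/=.
have cc : continuous (fun x => (a - 1)^-1 * cos (freq (- n) * x)).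
  by move=> t; apply: cvgM; [exact: cvg_cst|exact: continuous_cos_linear].
have cs : continuous (fun x => (a - 1)^-1 * sin (freq (- n) * x)).
  by move=> t; apply: cvgM; [exact: cvg_cst|exact: continuous_sin_linear].
rewrite !Rintegral_box//.
have iC (h : R -> R) : continuous h -> mu.-integrable `[1, a] (EFin \o h).
  move=> ch; apply: continuous_compact_integrable; first exact: segment_compact.
  exact: continuous_subspaceT.
have RE : \int[mu]_(x in `[1, a]) ((a - 1)^-1 * cos (freq (- n) * x)) = (n == 0)%:R.
  have [->|n0] := eqVneq n 0.
    transitivity (\int[mu]_(x in `[1, a]) ((a - 1)^-1)).
      by apply: eq_Rintegral => x _; rewrite /freq oppr0 mulr0 !mul0r cos0 mulr1.
    rewrite Rintegral_cst//= lebesgue_measure_itv/= lte_fin a1/= mulVf//.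
    by rewrite subr_eq0 gt_eqF.
  rewrite RintegralZl//; first by rewrite integral_cos_full_period ?oppr_eq0// mulr0.
  by apply: iC; exact: continuous_cos_linear.
have IE : \int[mu]_(x in `[1, a]) ((a - 1)^-1 * sin (freq (- n) * x)) = 0.
  have [->|n0] := eqVneq n 0.
    transitivity (\int[mu]_(x in `[1, a]) (0 : R)).
      by apply: eq_Rintegral => x _; rewrite /freq oppr0 mulr0 !mul0r sin0 mulr0.
    by rewrite Rintegral_cst//= mul0r.
  rewrite RintegralZl//; first by rewrite integral_sin_full_period ?oppr_eq0// mulr0.
  by apply: iC; exact: continuous_sin_linear.
by rewrite RE IE; case: eqP.
Qed.

(** The dilates of [[1, a)] by distinct powers of [a] are disjoint. *)
Lemma box_mul_scale k x : k != 0 -> box x * box (a ^ k * x) = 0.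
Proof.
move=> k0; rewrite /box; case: (boolP (1 <= x < a)) => x1; last by rewrite mul0r.
case: (boolP (1 <= a ^ k * x < a)) => x2; last by rewrite mulr0.
have x0 : 0 < x by case/andP : x1 => /(lt_le_trans ltr01).
have := dilexp_scale a1 k x0; rewrite !dilexp_eq0// addr0 => /esym/eqP.
by rewrite (negbTE k0).
Qed.

Lemma atom_box_orthonormal g h :
  innerL2 (atom a box g) (atom a box h) = (g == h)%:R.
Proof.
rewrite inner_atom//; try exact: L2_box.
rewrite [in RHS]eq_sym -subr_eq0; case: (h - g) => n k.
have [->|k0] := eqVneq k 0; first by rewrite inner_atom_box_same xpair_eqE eqxx andbT.
rewrite xpair_eqE (negbTE k0) andbF /innerL2 (@eq_cintegral _ _ (fun=> 0)).
  by rewrite /cintegral/= /Rintegral integral0.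
move=> x _; rewrite /atom /dil /= expr0z mul1r.
rewrite !(conjcM (Lambda _ _ _)) !(conjcM (Num.sqrt _)%:C%C).
have -> : (box (a ^ k * x))^*%C = box (a ^ k * x).
  by rewrite /box; case: (_ <= _ < _); rewrite ?conjc0 ?conjc1.
rewrite -[RHS](mul0r (Lambda a 0 x * (Num.sqrt (a ^ 0))%:C%C *
  (Lambda a n x)^*%C * (Num.sqrt (a ^ k))%:C%C^*%C)) -(box_mul_scale x k0).
by rewrite expr0z; ring.
Qed.

End Orthonormal.

(** * Multipliers of a closed subspace *)

Section Multipliers.
Context {R : realType} {I : choiceType} (e : I -> @L2space R).
Local Notation mu := (@lebesgue_measure R).
Local Notation q := (sqnorm (@L2ip R)).
Implicit Types (f g h : R -> R[i]).

Definition in_L2closure f := exists hf : L2 f, in_closure (@L2ip R) e (toL2 hf).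

Lemma in_L2closure_L2 f : in_L2closure f -> L2 f.
Proof. by case. Qed.

Lemma sqnorm_toL2B f (hf : L2 f) (w : @L2space R) :
  (q (toL2 hf - w))%:E = normL2sq (fun x => f x - w x).
Proof. by rewrite -normL2sq_sqnorm. Qed.

Lemma in_L2closureP f : L2 f ->
  (forall eps : R, 0 < eps -> exists2 g, in_L2closure g &
     (normL2sq (fun x => (f x - g x)%R) < eps%:E)%E) ->
  in_L2closure f.
Proof.
move=> hf H; exists hf; apply: in_closure_closed => eps /H [g [hg cg]].
by exists (toL2 hg) => //; rewrite -lte_fin sqnorm_toL2B.
Qed.

Lemma in_L2closure_approx f : in_L2closure f -> forall eps : R, 0 < eps ->
  exists2 w : @L2space R, in_span e w & (normL2sq (fun x => (f x - w x)%R) < eps%:E)%E.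
Proof.
move=> [hf cf] eps /cf [w sw fw]; exists w => //.
by rewrite -(sqnorm_toL2B hf) lte_fin.
Qed.

Lemma eq_in_L2closure f g : {in (@Rplus R), f =1 g} -> in_L2closure f -> in_L2closure g.
Proof.
move=> fg cf; apply: in_L2closureP; first exact: eq_L2 fg (in_L2closure_L2 cf).
move=> eps e0; exists f => //; rewrite (@eq_normL2sq _ _ 0); last first.
  by move=> x xR; rewrite /= fg// subrr.
by rewrite /normL2sq integral0_eq ?lte_fin// => x _; rewrite normc0 expr0n.
Qed.

Lemma in_L2closure_span (w : @L2space R) : in_span e w -> in_L2closure w.
Proof.
move=> sw; exists (L2spaceP w) => eps e0; exists w => //.
rewrite (_ : toL2 _ = w) ?subrr; last exact/val_inj.
by rewrite /sqnorm ip0l.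
Qed.

Lemma in_L2closureD f g : in_L2closure f -> in_L2closure g ->
  in_L2closure (fun x => f x + g x).
Proof.
move=> [hf cf] [hg cg]; exists (L2D hf hg).
rewrite (_ : toL2 _ = toL2 hf + toL2 hg); last exact/val_inj.
exact: in_closureD.
Qed.

Lemma in_L2closureZ c f : in_L2closure f -> in_L2closure (fun x => c * f x).
Proof.
move=> [hf cf]; exists (L2Z c hf).
rewrite (_ : toL2 _ = c *: toL2 hf); last exact/val_inj.
exact: in_closureZ.
Qed.

Lemma in_L2closure0 : in_L2closure (fun=> 0).
Proof. exact: (in_L2closure_span (in_span0 e)). Qed.

Lemma dominated_cvg_L2 (f_ : nat -> R -> R[i]) f (b : R -> R) :
  (forall n, cmeas (f_ n)) -> cmeas f ->
  mu.-integrable (@Rplus R) (EFin \o b) ->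
  (forall n x, Rplus x -> nsq (f_ n x) <= b x) ->
  (forall x, Rplus x -> nsq (f x) <= b x) ->
  (forall x, Rplus x -> nsq (f_ n x - f x) @[n --> \oo] --> (0 : R)) ->
  forall eps : R, 0 < eps -> exists n, (normL2sq (fun x => (f x - f_ n x)%R) < eps%:E)%E.
Proof.
move=> mf_ mf ib fb_ fb ff eps e0.
have mB n : cmeas (fun x => f x - f_ n x).
  have := cmeasD mf (cmeasM (cmeas_cst (-1)) (mf_ n)).
  by apply: eq_cmeas => x _; rewrite mulN1r.
have mn n : measurable_fun (@Rplus R) (fun x => (nsq (f x - f_ n x))%:E).
  by apply/measurable_EFinP; apply: cmeas_nsq.
have cf x : Rplus x -> (nsq (f x - f_ n x))%:E @[n --> \oo] --> (0 : R)%:E.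
  move=> xR; apply: cvg_EFin; first exact: nearW.
  rewrite (_ : _ \o _ = (fun n => nsq (f_ n x - f x))); first exact: ff.
  by apply/funext => n /=; rewrite -opprB nsqN.
have i4b : mu.-integrable (@Rplus R) (fun x => (4 * b x)%:E).
  have := @integrableZl _ _ _ mu _ measurable_Rplus 4 _ ib.
  by apply: eq_integrable => // x _ /=; rewrite EFinM.
have dom n x : Rplus x -> (`|(nsq (f x - f_ n x))%:E| <= (4 * b x)%:E)%E.
  move=> xR; rewrite /= lee_fin ger0_norm ?nsq_ge0//.
  apply: le_trans (nsqD_le _ _) _; rewrite nsqN.
  by have := fb _ xR; have := fb_ n _ xR; lra.
have [_ _] := @dominated_convergence _ _ R mu _ measurable_Rplus
  (fun n x => (nsq (f x - f_ n x))%:E) (fun=> (0 : R)%:E) (fun x => (4 * b x)%:E)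
  mn (measurable_cst _) (aeW mu cf) i4b (aeW mu (fun x n => dom n x)).
rewrite integral0_eq// => /fine_cvgP[_ /cvgr0Pnorm_lt /(_ eps e0)].
move=> [N _ /(_ N (leqnn N))] /= hN; exists N.
have {}hN : `|fine (normL2sq (fun x => f x - f_ N x))| < eps by exact: hN.
have hL : L2 (fun x => f x - f_ N x).
  apply: (L2_dominated (mB N) _ i4b) => x xR.
  by have := dom N x xR; rewrite /= lee_fin; apply: le_trans; exact: ler_norm.
by move: hN; rewrite normL2sqE//= lte_fin; apply: le_lt_trans; exact: ler_norm.
Qed.

(** Dominated convergence turns pointwise limits into limits in [L^2], and the
    closure of the span contains the latter. *)
Lemma in_L2closure_dominated (f_ : nat -> R -> R[i]) f (b : R -> R) :
  (forall n, in_L2closure (f_ n)) -> cmeas f ->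
  mu.-integrable (@Rplus R) (EFin \o b) ->
  (forall n x, Rplus x -> nsq (f_ n x) <= b x) ->
  (forall x, Rplus x -> nsq (f x) <= b x) ->
  (forall x, Rplus x -> nsq (f_ n x - f x) @[n --> \oo] --> (0 : R)) ->
  in_L2closure f.
Proof.
move=> cf_ mf ib fb_ fb ff; apply: in_L2closureP; first exact: L2_dominated ib.
move=> eps e0.
have [|n hn] := dominated_cvg_L2 _ mf ib fb_ fb ff e0.
  by move=> n; exact: L2_cmeas (in_L2closure_L2 (cf_ n)).
by exists (f_ n).
Qed.

(** Bounded functions by which multiplication preserves the closed span of [e]. *)
Definition multiplier h := [/\ cmeas h,
  exists M : R, forall x, Rplus x -> nsq (h x) <= M &
  forall f, in_L2closure f -> in_L2closure (fun x => h x * f x)].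

Lemma eq_multiplier g h : {in (@Rplus R), g =1 h} -> multiplier g -> multiplier h.
Proof.
move=> gh [mg [M gM] cg]; split; first exact: eq_cmeas mg.
  by exists M => x xR; rewrite -gh ?inE//; exact: gM.
by move=> f /cg; apply: eq_in_L2closure => x xR; rewrite gh.
Qed.

Lemma multiplier_cst c : multiplier (fun=> c).
Proof.
split; [exact: cmeas_cst | by exists (nsq c) | exact: in_L2closureZ].
Qed.

Lemma multiplierD g h : multiplier g -> multiplier h -> multiplier (fun x => g x + h x).
Proof.
move=> [mg [M gM] cg] [mh [N hN] ch]; split; first exact: cmeasD.
  exists (2 * (M + N)) => x xR; apply: le_trans (nsqD_le _ _) _.
  by rewrite ler_pM2l// lerD// ?gM// hN.
move=> f cf; apply: eq_in_L2closure (in_L2closureD (cg _ cf) (ch _ cf)) => x _.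
by rewrite mulrDl.
Qed.

Lemma multiplierM g h : multiplier g -> multiplier h -> multiplier (fun x => g x * h x).
Proof.
move=> [mg [M gM] cg] [mh [N hN] ch]; split; first exact: cmeasM.
  exists (M * N) => x xR; rewrite nsqM.
  by apply: ler_pM; rewrite ?nsq_ge0// ?gM// hN.
by move=> f /ch /cg; apply: eq_in_L2closure => x _; rewrite mulrA.
Qed.

Lemma multiplierX h n : multiplier h -> multiplier (fun x => h x ^+ n).
Proof.
move=> mh; elim: n => [|n IH]; first exact: multiplier_cst.
by apply: eq_multiplier (multiplierM mh IH) => x _; rewrite exprS.
Qed.

Lemma multiplier_sum (J : Type) (r : seq J) (h : J -> R -> R[i]) :
  (forall i, multiplier (h i)) -> multiplier (fun x => \sum_(i <- r) h i x).
Proof.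
move=> mh; elim: r => [|i r IH].
  by apply: eq_multiplier (multiplier_cst 0) => x _; rewrite big_nil.
by apply: eq_multiplier (multiplierD (mh i) IH) => x _; rewrite big_cons.
Qed.

Lemma multiplier_lim (h_ : nat -> R -> R[i]) h (M : R) :
  (forall n, multiplier (h_ n)) -> cmeas h ->
  (forall n x, Rplus x -> nsq (h_ n x) <= M) ->
  (forall x, Rplus x -> nsq (h x) <= M) ->
  (forall x, Rplus x -> nsq (h_ n x - h x) @[n --> \oo] --> (0 : R)) ->
  multiplier h.
Proof.
move=> mh_ mh hM_ hM hh; split=> //; first by exists M.
move=> f cf; have lf := in_L2closure_L2 cf.
apply: (@in_L2closure_dominated (fun n x => h_ n x * f x) _ (fun x => M * nsq (f x))).
- by move=> n; case: (mh_ n) => _ _; apply.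
- by apply: cmeasM => //; exact: L2_cmeas.
- have := @integrableZl _ _ _ mu _ measurable_Rplus M _ (L2_integrable lf).
  by apply: eq_integrable => // x _ /=; rewrite EFinM.
- by move=> n x xR; rewrite nsqM ler_wpM2r ?nsq_ge0// hM_.
- by move=> x xR; rewrite nsqM ler_wpM2r ?nsq_ge0// hM.
- move=> x xR; rewrite (_ : (fun n => _) = (fun n => nsq (h_ n x - h x) * nsq (f x))).
    by rewrite -[X in _ --> X](mul0r (nsq (f x))); apply: cvgM; [exact: hh|exact: cvg_cst].
  by apply/funext => n; rewrite -mulrBl nsqM.
Qed.

(** Multiplication by a bounded function is continuous, so it is enough to know
    its effect on the generators. *)
Lemma multiplier_gen h (M : R) : cmeas h -> (forall x, Rplus x -> nsq (h x) <= M) ->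
  (forall i, in_L2closure (fun x => h x * e i x)) -> multiplier h.
Proof.
move=> mh hM hg; split=> //; first by exists M.
move=> f cf; have lf := in_L2closure_L2 cf.
have hspan (w : @L2space R) : in_span e w -> in_L2closure (fun x => h x * w x).
  move: w; apply: in_span_ind => [|u v hu hv|c i].
  - by apply: eq_in_L2closure in_L2closure0 => x _; rewrite mulr0.
  - by apply: eq_in_L2closure (in_L2closureD hu hv) => x _; rewrite -mulrDr.
  - by apply: eq_in_L2closure (in_L2closureZ c (hg i)) => x _; rewrite mulrCA.
apply: in_L2closureP => [|eps e0]; first exact: L2M hM lf.
have M0 : 0 <= M.
  by apply: le_trans (hM 1 _); rewrite ?nsq_ge0// /Rplus/= in_itv/= andbT.
have M1 : 0 < M + 1 by lra.
have [w sw fw] := in_L2closure_approx cf (divr_gt0 e0 M1).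
exists (fun x => h x * w x); first exact: hspan.
have lw : L2 (fun x => f x - w x).
  have := L2D lf (L2Z (-1) (L2spaceP w)); apply: eq_L2 => x _; by rewrite mulN1r.
apply: le_lt_trans (_ : ((M + 1)%:E * normL2sq (fun x => (f x - w x)%R) < _)%E); last first.
  move: fw; rewrite normL2sqE// -EFinM !lte_fin ltr_pdivlMr// mulrC.
  exact.
rewrite /normL2sq -ge0_integralZl_EFin//; last 3 first.
- by move=> x _; rewrite lee_fin sqr_ge0.
- by apply/measurable_EFinP; apply: (cmeas_nsq (L2_cmeas lw)).
- exact: ltW.
apply: ge0_le_integral => //.
- by move=> x _; rewrite lee_fin sqr_ge0.
- apply/measurable_EFinP; apply: (@cmeas_nsq _ (fun x => h x * f x - h x * w x)).
  apply: eq_cmeas (cmeasM mh (L2_cmeas lw)) => x _; by rewrite mulrBr.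
- apply/measurable_EFinP; apply: measurable_funM => //; exact: (cmeas_nsq (L2_cmeas lw)).
- move=> x xR; rewrite -EFinM lee_fin -mulrBr -!/(nsq _) nsqM ler_wpM2r ?nsq_ge0//.
  by apply: le_trans (hM _ xR) _; lra.
Qed.

Lemma cvg_nsq_real (u : nat -> R) (l : R) : u n @[n --> \oo] --> l ->
  nsq ((u n)%:C%C - l%:C%C) @[n --> \oo] --> (0 : R).
Proof.
move=> ul; rewrite (_ : (fun n => _) = (fun n => (u n - l) * (u n - l))).
  have ul0 : u n - l @[n --> \oo] --> (0 : R).
    by rewrite -[X in _ --> X](subrr l); apply: cvgB => //; exact: cvg_cst.
  by rewrite -[X in _ --> X](mulr0 (0 : R)); apply: cvgM.
by apply/funext => n; rewrite -rmorphB/= nsqC.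
Qed.

End Multipliers.

(** * Polynomials converging to a step function *)

Section StepPolynomials.
Context {R : realType}.
Implicit Types (t u r : R) (n : nat).

(** Polynomials that converge to the indicator of [u < 1/2] at every point of
    [[0, 1]], the point [1/2] included.  Writing [t = u ^ (2 n)] and
    [N = n 4 ^ n], the product [N t = n (2 u) ^ (2 n)] tends to [0] for
    [u < 1/2] and is at least [n] for [u >= 1/2], while
    [1 - N t <= (1 - t) ^ N <= 1 / (1 + N t)]. *)
Definition step_poly n u : R := (1 - u ^+ (2 * n)) ^+ (n * 4 ^ n).

Lemma bernoulli_inequality n t : -1 <= t -> 1 + n%:R * t <= (1 + t) ^+ n.
Proof.
move=> t1; elim: n => [|n IH]; first by rewrite mul0r addr0 expr0.
rewrite exprS -natr1; apply: le_trans (ler_wpM2l _ IH); last by lra.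
have : 0 <= n%:R * t ^+ 2 by rewrite mulr_ge0 ?sqr_ge0.
nra.
Qed.

Lemma step_poly_itv n u : 0 <= u <= 1 -> 0 <= step_poly n u <= 1.
Proof.
move=> /andP[u0 u1]; have t0 : 0 <= u ^+ (2 * n) by exact: exprn_ge0.
have t1 : u ^+ (2 * n) <= 1 by exact: exprn_ile1.
rewrite exprn_ge0 ?exprn_ile1//; lra.
Qed.

(** A telescoped form of [n r ^ n <= 1 + r + ... + r ^ (n - 1)]; it keeps
    [n r ^ n] bounded for [r < 1]. *)
Lemma natr_mul_expr_le n r : 0 <= r <= 1 -> n%:R * r ^+ n * (1 - r) <= 1 - r ^+ n.
Proof.
move=> /andP[r0 r1]; elim: n => [|n IH]; first by rewrite !mul0r expr0 subrr.
have := ler_wpM2l r0 IH.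
have : r ^+ n.+1 * (1 - r) <= 1 - r.
  by rewrite -[leRHS]mul1r ler_wpM2r ?subr_ge0// exprn_ile1.
rewrite -natr1 exprS; lra.
Qed.

Lemma step_poly_cvg1 u : 0 <= u < 2^-1 -> step_poly n u @[n --> \oo] --> (1 : R).
Proof.
move=> /andP[u0 u2].
have r0 : 0 <= 2 * u by lra.
have r1 : 2 * u < 1 by lra.
apply: (@squeeze_cvgr _ _ _ _ (fun n => 1 - (1 - 2 * u)^-1 * (2 * u) ^+ n) (fun=> 1)).
- apply: nearW => n; have /andP[s0 ->] := @step_poly_itv n u ltac:(lra).
  rewrite andbT; have t1 : u ^+ (2 * n) <= 1 by apply: exprn_ile1; lra.
  have := @bernoulli_inequality (n * 4 ^ n) (- u ^+ (2 * n)) ltac:(lra).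
  apply: le_trans; rewrite lerD2l mulrN lerN2 natrM natrX.
  have -> : n%:R * 4%:R ^+ n * u ^+ (2 * n) = n%:R * (2 * u) ^+ n * (2 * u) ^+ n.
    rewrite -mulrA -[RHS]mulrA; congr (_ * _).
    by rewrite exprM -!exprMn; congr (_ ^+ _); ring.
  rewrite ler_wpM2r ?exprn_ge0// -[leRHS]mul1r ler_pdivlMr ?subr_gt0//.
  have := @natr_mul_expr_le n (2 * u) ltac:(lra).
  have : 0 <= (2 * u) ^+ n by exact: exprn_ge0.
  lra.
- rewrite -[X in _ --> X]subr0; apply: cvgB; first exact: cvg_cst.
  rewrite -[X in _ --> X](mulr0 ((1 - 2 * u)^-1)); apply: cvgM; first exact: cvg_cst.
  by apply: cvg_expr; rewrite ger0_norm.
- exact: cvg_cst.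
Qed.

Lemma step_poly_cvg0 u : 2^-1 <= u <= 1 -> step_poly n u @[n --> \oo] --> (0 : R).
Proof.
move=> /andP[u2 u1].
apply: (@squeeze_cvgr _ _ _ _ (fun=> 0) harmonic).
- apply: nearW => n; have /andP[s0 _] := @step_poly_itv n u ltac:(lra).
  rewrite s0 /=; set t := u ^+ (2 * n); set N := (n * 4 ^ n)%N.
  have t0 : 0 <= t by apply: exprn_ge0; lra.
  have t1 : t <= 1 by apply: exprn_ile1; lra.
  rewrite /harmonic/= -[leRHS]mul1r ler_pdivlMr//.
  apply: (@le_trans _ _ ((1 - t) ^+ N * (1 + t) ^+ N)).
    rewrite ler_wpM2l//; apply: le_trans (bernoulli_inequality N _); last by lra.
    rewrite -natr1 addrC lerD2l /N natrM -mulrA ler_peMr//.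
    rewrite natrX /t exprM -exprMn; apply: exprn_ege1.
    by have : 0 <= (2 * u - 1) by [lra]; nra.
  rewrite -exprMn; apply: exprn_ile1; first by nra.
  by nra.
- exact: cvg_cst.
- exact: cvg_harmonic.
Qed.

End StepPolynomials.

(** * Indicators of Borel sets are multipliers *)

Section BorelMultipliers.
Context {R : realType} (a : R).
Hypothesis a1 : 1 < a.
Local Notation mu := (@lebesgue_measure R).
Implicit Types (m j k : int) (x y s : R) (B : set R).

Let a0 : 0 < a. Proof. exact: lt_trans a1. Qed.

Definition box_atom (g : int * int) : @L2space R := toL2 (L2_atom a1 g (@L2_box R a)).

Local Notation closure := (in_L2closure box_atom).
Local Notation mult := (multiplier box_atom).

Definition cindic B x : R[i] := (\1_B x)%:C%C.

Lemma cmeas_cindic B : measurable B -> cmeas (cindic B).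
Proof. by move=> mB; apply: cmeas_real; apply: measurable_indic. Qed.

Lemma nsq_cindic_le1 B x : nsq (cindic B x) <= 1.
Proof. by rewrite /cindic nsqC indicE; case: (_ \in _); rewrite ?expr1n ?expr0n. Qed.

(** Multiplication by [Lambda_m] permutes the generators up to a constant. *)
Lemma multiplier_Lambda m : mult (Lambda a m).
Proof.
apply: (@multiplier_gen _ _ _ _ ((a - 1)^-1)).
- exact: cmeas_Lambda.
- by move=> x _; rewrite nsq_Lambda.
- move=> [n k]; apply: eq_in_L2closure (in_L2closureZ ((Num.sqrt (a - 1))^-1)%:C%C
    (in_L2closure_span (in_span_gen box_atom (m + n, k)))) => x _.
  by rewrite /box_atom/= /atom/= [RHS]mulrA LambdaM// mulrA.
Qed.

Lemma multiplier_cos (b : R) :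
  mult (fun x => (cos (2 * pi * theta a x / (a - 1) + b))%:C%C).
Proof.
have s0 : Num.sqrt (a - 1) != 0 by rewrite gt_eqF// sqrtr_gt0 subr_gt0.
pose c (z : R) : R[i] := (2^-1 * Num.sqrt (a - 1))%:C%C * expi z.
apply: eq_multiplier (multiplierD
  (multiplierM (multiplier_cst _ (c b)) (multiplier_Lambda 1))
  (multiplierM (multiplier_cst _ (c (- b))) (multiplier_Lambda (-1)))) => x _.
rewrite /c !LambdaE !mulr1 mulrN1 !mulNr.
set t := 2 * pi * theta a x / (a - 1).
rewrite /expi cosD !sinN !cosN; simpc; congr (_ +i* _)%C; field => //.
Qed.

Lemma measurable_theta_gt s : measurable [set x | s < theta a x].
Proof.
have := @measurable_theta R a a1 measurableT `]s, +oo[%classic (measurable_itv _).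
rewrite setTI; congr measurable; apply/seteqP; split => x /=; by rewrite in_itv/= andbT.
Qed.

(** On [[1, a)] the product [sin (pi (t - s) / (a - 1)) sin (pi (a - t) / (a - 1))]
    is positive exactly for [t > s]: the second factor is nonnegative and
    vanishes only at [t = 1].  The product is a difference of cosines, the only
    variable one of frequency [2 pi / (a - 1)], hence a multiplier. *)
Lemma multiplier_theta_gt s : 1 <= s < a -> mult (cindic [set x | s < theta a x]).
Proof.
move=> /andP[s1 sa].
pose al x := pi * (theta a x - s) / (a - 1).
pose be x := pi * (a - theta a x) / (a - 1).
pose u x := (1 - sin (al x) * sin (be x)) / 2.
have a10 : 0 < a - 1 by rewrite subr_gt0.
have u01 x : 0 <= u x <= 1.
  have h y : -1 <= sin y <= 1 by rewrite sin_geN1 sin_le1.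
  by move: (h (al x)) (h (be x)); rewrite /u => /andP[? ?] /andP[? ?]; apply/andP; split; nra.
have mu_ : mult (fun x => (u x)%:C%C).
  pose b := - (pi * (s + a) / (a - 1)).
  apply: eq_multiplier (multiplierD
    (multiplierM (multiplier_cst _ (- (4^-1))%:C%C) (multiplier_cos b))
    (multiplier_cst _ (2^-1 + 4^-1 * cos (pi * (a - s) / (a - 1)))%:C%C)) => x _.
  rewrite -rmorphM -rmorphD/=; congr (_%:C%C); rewrite /u.
  have -> : 2 * pi * theta a x / (a - 1) + b = al x - be x.
    by rewrite /b /al /be; field; rewrite gt_eqF.
  have -> : pi * (a - s) / (a - 1) = al x + be x.
    by rewrite /al /be; field; rewrite gt_eqF.
  by rewrite cosB cosD; field.
have ult x : Rplus x -> (u x < 2^-1) = (s < theta a x).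
  rewrite /Rplus/= in_itv/= andbT => /(theta_itv a1)/andP[t1 ta].
  have -> : (u x < 2^-1) = (0 < sin (al x) * sin (be x)).
    by rewrite /u; apply/idP/idP => ?; lra.
  have be0 : 0 < be x by rewrite /be divr_gt0// mulr_gt0 ?pi_gt0// subr_gt0.
  have bepi : be x <= pi by rewrite /be ler_pdivrMr// ler_pM2l ?pi_gt0//; lra.
  have sb : 0 <= sin (be x) by rewrite sin_ge0_pi// (ltW be0).
  case: (ltP s (theta a x)) => st.
    have bepi' : be x < pi by rewrite /be ltr_pdivrMr// ltr_pM2l ?pi_gt0//; lra.
    rewrite mulr_gt0// sin_gt0_pi//; first last.
      by rewrite be0.
    rewrite /al divr_gt0// ?mulr_gt0 ?pi_gt0 ?subr_gt0//=.
    by rewrite ltr_pdivrMr// ltr_pM2l ?pi_gt0//; lra.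
  apply/negbTE; rewrite -leNgt; apply: mulr_le0_ge0 => //.
  rewrite -oppr_ge0 -sinN sin_ge0_pi//.
  have -> : - al x = pi * (s - theta a x) / (a - 1) by rewrite /al; field; rewrite gt_eqF.
  rewrite divr_ge0 ?(ltW a10)// ?mulr_ge0 ?pi_ge0 ?subr_ge0//=.
  by rewrite ler_pdivrMr// ler_pM2l ?pi_gt0//; lra.
apply: (@multiplier_lim _ _ _ (fun n x => (step_poly n (u x))%:C%C) _ 1).
- move=> n; apply: eq_multiplier (multiplierX (n * 4 ^ n)
    (multiplierD (multiplier_cst _ 1) (multiplierM (multiplier_cst _ (-1))
      (multiplierX (2 * n) mu_)))) => x _.
  by rewrite /step_poly rmorphXn/= rmorphB/= rmorphXn/= mulN1r.
- by apply: cmeas_cindic; exact: measurable_theta_gt.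
- move=> n x _; rewrite nsqC; have /andP[h0 h1] := step_poly_itv n (u01 x).
  exact: exprn_ile1.
- by move=> x _; exact: nsq_cindic_le1.
- move=> x xR; apply: cvg_nsq_real.
  rewrite indicE (_ : (x \in _) = (u x < 2^-1)); last by rewrite ult//; apply/idP/idP; rewrite inE.
  have /andP[x0 x1] := u01 x.
  case: ltP => ux; first by apply: step_poly_cvg1; rewrite x0.
  by apply: step_poly_cvg0; rewrite ux.
Qed.

Lemma measurable_dilexp_gt j : measurable [set x | j < dilexp a x].
Proof.
have := @measurable_dilexp R a measurableT `]j%:~R, +oo[%classic (measurable_itv _).
rewrite setTI; congr measurable; apply/seteqP; split => x /=; by rewrite in_itv/= andbT ltr_int.
Qed.

Lemma box_scale_dilexp k x : 0 < x -> box a (a ^ k * x) != 0 -> dilexp a x = - k.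
Proof.
move=> x0; rewrite /box; case: (boolP (_ <= _ < _)) => [h _|]; last by rewrite eqxx.
have := dilexp_scale a1 k x0; rewrite (dilexp_eq0 a1 h) => /esym/eqP.
by rewrite addrC addr_eq0 => /eqP.
Qed.

(** Each generator lives where [dilexp] is constant, so the cut-off keeps it or
    kills it. *)
Lemma multiplier_dilexp_gt j : mult (cindic [set x | j < dilexp a x]).
Proof.
apply: (@multiplier_gen _ _ _ _ 1).
- by apply: cmeas_cindic; exact: measurable_dilexp_gt.
- by move=> x _; exact: nsq_cindic_le1.
- move=> [m k].
  apply: eq_in_L2closure (in_L2closureZ (j < - k)%R%:R
    (in_L2closure_span (in_span_gen box_atom (m, k)))) => x.
  rewrite inE /Rplus/= in_itv/= andbT => x0.
  rewrite /atom /dil/=; have [->|b0] := eqVneq (box a (a ^ k * x)) 0; first by rewrite !mulr0.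
  rewrite /cindic indicE; congr (_ * _); have dk := box_scale_dilexp x0 b0.
  rewrite (_ : (x \in _) = (j < - k)); first by case: (j < _).
  by rewrite -dk; apply/idP/idP; rewrite inE.
Qed.

Definition mult_set B := measurable B /\ mult (cindic B).

Lemma mult_setC B : mult_set B -> mult_set (~` B).
Proof.
move=> [mB hB]; split; first exact: measurableC.
apply: eq_multiplier (multiplierD (multiplier_cst _ 1)
  (multiplierM (multiplier_cst _ (-1)) hB)) => x _.
by rewrite /cindic !indicE in_setC; case: (x \in B) => /=; rewrite mulN1r ?subrr ?subr0.
Qed.

Lemma mult_setI B B' : mult_set B -> mult_set B' -> mult_set (B `&` B').
Proof.
move=> [mB hB] [mB' hB']; split; first exact: measurableI.
apply: eq_multiplier (multiplierM hB hB') => x _.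
by rewrite /cindic !indicE in_setI; case: (x \in B); case: (x \in B'); rewrite ?mulr1 ?mulr0.
Qed.

Lemma mult_setU B B' : mult_set B -> mult_set B' -> mult_set (B `|` B').
Proof.
move=> hB hB'; rewrite -(setCK B) -(setCK B') -setCI.
by apply/mult_setC/mult_setI; exact: mult_setC.
Qed.

Lemma mult_set0 : mult_set set0.
Proof.
split => //; apply: eq_multiplier (multiplier_cst _ 0) => x _.
by rewrite /cindic indicE in_set0.
Qed.

Lemma mult_set_bigcup (F : nat -> set R) : (forall n, mult_set (F n)) -> mult_set (\bigcup_n F n).
Proof.
move=> hF; have mF : measurable (\bigcup_n F n).
  by apply: bigcupT_measurable => n; case: (hF n).
have hU n : mult_set (\big[setU/set0]_(i < n) F i).
  elim: n => [|n IH]; first by rewrite big_ord0; exact: mult_set0.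
  by rewrite big_ord_recr/=; exact: mult_setU.
split=> //; apply: (@multiplier_lim _ _ _ (fun n => cindic (\big[setU/set0]_(i < n) F i)) _ 1).
- by move=> n; case: (hU n).
- exact: cmeas_cindic.
- by move=> n x _; exact: nsq_cindic_le1.
- by move=> x _; exact: nsq_cindic_le1.
- move=> x _; case: (pselect ((\bigcup_n F n) x)) => [[n0 _ Fx]|nFx].
    apply: cvg_near_cst; exists n0.+1 => // n /= n0n.
    rewrite /cindic !indicE mem_set; last by rewrite -bigcup_mkord; exists n0.
    by rewrite mem_set ?subrr ?nsq0//; exists n0.
  apply: cvg_near_cst; apply: nearW => n.
  rewrite /cindic !indicE memNset; last first.
    by rewrite -bigcup_mkord => -[i _ Fi]; apply: nFx; exists i.
  by rewrite memNset// subrr nsq0.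
Qed.

Lemma eq_mult_set B B' : measurable B' -> mult_set B ->
  (forall x, Rplus x -> B x <-> B' x) -> mult_set B'.
Proof.
move=> mB' [mB hB] BB'; split=> //; apply: eq_multiplier hB => x.
rewrite inE => /BB' [h h']; rewrite /cindic !indicE.
by have -> : (x \in B) = (x \in B') by apply/idP/idP; rewrite !inE.
Qed.

(** Since [x = theta x * a ^ dilexp x], the order of the positive reals is
    lexicographic in [(dilexp x, theta x)]. *)
Lemma mult_set_ray s : mult_set `]s, +oo[%classic.
Proof.
have [s0|s0] := leP s 0.
  have := mult_setC mult_set0; rewrite setC0 => /eq_mult_set; apply; first exact: measurable_itv.
  move=> x; rewrite /Rplus/= !in_itv/= !andbT => x0.
  by split=> // _; exact: le_lt_trans x0.
have hJ j : mult_set [set x | j < dilexp a x].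
  by split; [exact: measurable_dilexp_gt|exact: multiplier_dilexp_gt].
have hT : mult_set [set x | theta a s < theta a x].
  by split; [exact: measurable_theta_gt|apply: multiplier_theta_gt; exact: theta_itv].
have hS := mult_setU (hJ (dilexp a s))
  (mult_setI (mult_setI (mult_setC (hJ (dilexp a s))) (hJ (dilexp a s - 1))) hT).
apply: (eq_mult_set _ hS).
  exact: measurable_itv.
move=> x; rewrite /Rplus/= !in_itv/= !andbT => x0.
have /andP[xl xu] := dilexp_itv a1 x0; have /andP[sl su] := dilexp_itv a1 s0.
have mono j k : j <= k -> a ^ j <= a ^ k by move=> jk; rewrite ler_weXz2l// ltW.
case: (ltgtP (dilexp a s) (dilexp a x)) => sx.
- split=> [_|_]; last by left.
  by apply: lt_le_trans su (le_trans _ xl); apply: mono; rewrite lezD1.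
- split; first by move=> [//|[[_ /=]]]; rewrite ltrBlDr ltzD1 leNgt sx.
  move=> sx'; have : x < s by apply: lt_le_trans xu (le_trans _ sl); apply: mono; rewrite lezD1.
  by move=> /(lt_trans sx'); rewrite ltxx.
- split=> [[|[_]]|sx'].
  + by [].
  + by rewrite /theta/= sx ltr_pM2r// invr_gt0 exprz_gt0.
  + right; split; first by split => //; rewrite sx gtrBl.
    by rewrite /theta/= sx ltr_pM2r// invr_gt0 exprz_gt0.
Qed.

Lemma measurable_mult_set B : measurable B -> mult_set B.
Proof.
have H : <<s @RGenOInfty.G R >> `<=` mult_set.
  apply: smallest_sub.
    split; first exact: mult_set0.
      by move=> A hA; rewrite setTD; exact: mult_setC.
    exact: mult_set_bigcup.
  by move=> _ [x ->]; exact: mult_set_ray.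
move=> mB; apply: H; have : (@ocitv R).-sigma.-measurable B by [].
by rewrite RGenOInfty.measurableE.
Qed.

End BorelMultipliers.

(** * Density of the orthonormal system *)

Section Completeness.
Context {R : realType} (a : R).
Hypothesis a1 : 1 < a.
Local Notation mu := (@lebesgue_measure R).
Implicit Types (m j k : int) (x y s : R) (B : set R).

Let a0 : 0 < a. Proof. exact: lt_trans a1. Qed.

Local Notation closure := (in_L2closure (box_atom a1)).
Local Notation mult := (multiplier (box_atom a1)).

Import HBNNSimple.

Lemma multiplier_nnsfun (g : {nnsfun (measurableTypeR R) >-> R}) : mult (fun x => (g x)%:C%C).
Proof.
apply: eq_multiplier (@multiplier_sum _ _ _ _ (fset_set (range g))
  (fun y x => y%:C%C * cindic (g @^-1` [set y]) x) _) => [x _|y].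
  rewrite /= (fimfunE g x) fsbig_finite//= raddf_sum/=; apply: eq_bigr => y _.
  by rewrite -real_complexM.
apply: multiplierM; first exact: multiplier_cst.
have mB : measurable (g @^-1` [set y]) by exact: measurable_funPTI.
by have [] := measurable_mult_set a1 mB.
Qed.

Lemma box_scaleE k x : 0 < x -> box a (a ^ (- k) * x) = (dilexp a x == k)%:R.
Proof.
move=> x0; have ak : 0 < a ^ k by exact: exprz_gt0.
have [xk|xk] := eqVneq (dilexp a x) k.
  have := dilexp_itv a1 x0; rewrite xk expfzDr ?gt_eqF// expr1z => h.
  by rewrite /box -invr_expz ler_pdivlMl// ltr_pdivrMl// mulr1 h.
apply/eqP/negP => b0; move/negP: xk; apply.
by rewrite (box_scale_dilexp a1 x0 (introN idP b0)) opprK.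
Qed.

Lemma closure_dilexp_eq k : closure (cindic [set x | dilexp a x = k]).
Proof.
have s0 : Num.sqrt (a - 1) != 0 by rewrite gt_eqF// sqrtr_gt0 subr_gt0.
have t0 : Num.sqrt (a ^ (- k)) != 0 by rewrite gt_eqF// sqrtr_gt0 exprz_gt0.
apply: eq_in_L2closure (in_L2closureZ (Num.sqrt (a - 1) / Num.sqrt (a ^ (- k)))%:C%C
    (in_L2closure_span (in_span_gen (box_atom a1) (0, - k)))) => x.
rewrite inE /Rplus/= in_itv/= andbT => x0.
rewrite /atom /dil/= box_scaleE// LambdaE mulr0 !mul0r expi0 mulr1 /cindic indicE.
rewrite (_ : (x \in _) = (dilexp a x == k)); last first.
  by apply/idP/idP; rewrite inE => /eqP.
rewrite !mulrA -!real_complexM.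
have -> : Num.sqrt (a - 1) / Num.sqrt (a ^ (- k)) * (Num.sqrt (a - 1))^-1 *
    Num.sqrt (a ^ (- k)) = 1.
  by field; rewrite s0 t0.
by rewrite mul1r; case: (_ == _).
Qed.

Definition slab (n : nat) : set R := [set x | - (n%:Z) <= dilexp a x < n%:Z].

Lemma closure_slab n : closure (cindic (slab n)).
Proof.
elim: n => [|n IH].
  apply: eq_in_L2closure (in_L2closure0 _) => x _.
  by rewrite /cindic indicE memNset// /slab/=; lia.
apply: eq_in_L2closure (in_L2closureD IH (in_L2closureD (closure_dilexp_eq n%:Z)
  (closure_dilexp_eq (- (n.+1)%:Z)))) => x _.
have CD (s t : R) : s%:C%C + t%:C%C = (s + t)%:C%C by rewrite -raddfD.
rewrite /cindic !indicE !CD -!natrD; congr (_%:R%:C%C).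
have E (P : bool) (S : set R) : (S x <-> P) -> (x \in S) = P.
  by move=> SP; apply/idP/idP; rewrite inE => /SP.
rewrite (E (- (n%:Z) <= dilexp a x < n%:Z) (slab n))//.
rewrite (E (- (n.+1%:Z) <= dilexp a x < n.+1%:Z) (slab n.+1))//.
rewrite (E (dilexp a x == n%:Z)); last by split => /eqP.
rewrite (E (dilexp a x == - (n.+1%:Z))); last by split => /eqP.
by lia.
Qed.

(** Simple functions [g n] increase to [r]; they are multipliers, so their
    products with the indicators of the growing slabs lie in the closed span,
    and these products are dominated by [r]. *)
Lemma closure_ge0 (r : R -> R) : (forall x, Rplus x -> 0 <= r x) ->
  L2 (fun x => (r x)%:C%C) -> closure (fun x => (r x)%:C%C).
Proof.
move=> r0 hr; have [mr _] := L2_cmeas hr.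
have mer : measurable_fun (@Rplus R : set (measurableTypeR R)) (EFin \o r).
  exact/measurable_EFinP.
pose g := nnsfun_approx measurable_Rplus mer.
have g_le n x : Rplus x -> g n x <= r x.
  by move=> xR; rewrite -lee_fin /g nnsfun_approxE; apply: le_approx.
have g_cvg x : Rplus x -> g n x @[n --> \oo] --> r x.
  move=> xR; have /fine_cvgP[_] := @cvg_nnsfun_approx _ _ _ _ measurable_Rplus _ mer
    (fun t tR => r0 t tR) x xR.
  exact.
apply: (@in_L2closure_dominated _ _ _ (fun n x => (g n x)%:C%C * cindic (slab n) x) _
  (fun x => nsq (r x)%:C%C)).
- by move=> n; have [_ _ hm] := multiplier_nnsfun (g n); apply: hm; exact: closure_slab.
- exact: L2_cmeas.
- exact: L2_integrable.
- move=> n x xR; rewrite nsqM !nsqC -[leRHS]mulr1; apply: ler_pM; rewrite ?sqr_ge0//.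
    by rewrite lerXn2r ?nnegrE ?g_le// ?r0//; exact: fun_ge0.
- by [].
- move=> x xR; have := cvg_nsq_real (g_cvg _ xR).
  apply: cvg_trans; apply: near_eq_cvg; exists `|dilexp a x|.+1 => // N /= hn.
  by rewrite /cindic indicE mem_set ?mulr1// /slab/=; lia.
Qed.

Theorem closure_L2 f : L2 f -> closure f.
Proof.
move=> hf; have [rf mf] := L2_cmeas hf.
have pos (h : R -> R) : measurable_fun (@Rplus R) h ->
    (forall x, h x ^+ 2 <= nsq (f x)) -> closure (fun x => (Num.max (h x) 0)%:C%C).
  move=> mh hle; apply: closure_ge0 => [x _|]; first by rewrite le_max lexx orbT.
  apply: (@L2_dominated _ _ (fun x => nsq (f x))).
  - by apply: cmeas_real; apply: measurable_maxr.
  - move=> x _; rewrite nsqC; apply: le_trans (hle x).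
    by case: (leP (h x) 0); rewrite ?expr0n/= ?sqr_ge0.
  - exact: L2_integrable.
have re2 x : complex.Re (f x) ^+ 2 <= nsq (f x) by rewrite nsqE lerDl sqr_ge0.
have im2 x : complex.Im (f x) ^+ 2 <= nsq (f x) by rewrite nsqE lerDr sqr_ge0.
have mN (h : R -> R) : measurable_fun (@Rplus R) h -> measurable_fun (@Rplus R) (fun x => - h x).
  by move=> mh; exact: measurableT_comp.
have c1 := pos _ rf re2; have c2 := pos _ mf im2.
have c3 : closure (fun x => (Num.max (- complex.Re (f x)) 0)%:C%C).
  by apply: pos => [|x]; [exact: mN | rewrite sqrrN].
have c4 : closure (fun x => (Num.max (- complex.Im (f x)) 0)%:C%C).
  by apply: pos => [|x]; [exact: mN | rewrite sqrrN].
have posneg (t : R) : t = Num.max t 0 - Num.max (- t) 0.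
  by rewrite /Num.max; case: ifP; case: ifP; lra.
apply: eq_in_L2closure (in_L2closureD (in_L2closureD c1 (in_L2closureZ (-1) c3))
  (in_L2closureZ (0 +i* 1)%C (in_L2closureD c2 (in_L2closureZ (-1) c4)))) => x _.
rewrite [RHS](_ : _ = (complex.Re (f x) +i* complex.Im (f x))%C); last by case: (f x).
by simpc; congr (_ +i* _)%C; exact/esym/posneg.
Qed.

Lemma box_atom_dense (v : @L2space R) : in_closure (@L2ip R) (box_atom a1) v.
Proof.
have [hv cv] := closure_L2 (L2spaceP v).
by rewrite (_ : v = toL2 hv)//; exact/val_inj.
Qed.

End Completeness.

(** * Riesz bases of dilates and modulates *)

Section FrameBounds.
Context {R : realType} {I : choiceType} (e : I -> @L2space R).
Local Notation q := (sqnorm (@L2ip R)).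
Local Notation ef := (fun i => e i : R -> R[i]).

Lemma lincomb_lcomb (F : {fset I}) b : lincomb ef F b = lcomb e F b.
Proof. by apply/funext => x; rewrite L2space_lincomb. Qed.

Lemma frame_boundsP : is_frame ef -> exists A B : R,
  [/\ 0 < A, A <= B, lower_frame_bound (@L2ip R) e A & upper_frame_bound (@L2ip R) e B].
Proof.
move=> [_ [A [B [A0 AB H]]]]; exists A, B; split => //.
- move=> f s hs; have [H1 _] := H f (L2spaceP f).
  rewrite -lee_fin EFinM -normL2sq_sqnorm; apply: (le_trans H1).
  apply: ge_ereal_sup => _ [X [fX _] <-].
  by rewrite fsbig_finite//= sumEFin lee_fin; exact: hs.
- move=> f F; have [_ H2] := H f (L2spaceP f).
  rewrite -lee_fin EFinM -normL2sq_sqnorm; apply: le_trans H2.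
  apply: esum_ge; exists [set` F] => //.
  by rewrite fsbig_finite//= set_fsetK sumEFin.
Qed.

Lemma riesz_boundsP : is_riesz_basis ef -> exists A B : R,
  [/\ 0 < A, A <= B,
      forall (F : {fset I}) b, A * \sum_(i <- F) nsq (b i) <= q (lcomb e F b) &
      forall (F : {fset I}) b, q (lcomb e F b) <= B * \sum_(i <- F) nsq (b i)].
Proof.
move=> [_ _ [A [B [A0 AB H]]]]; exists A, B; split => // F b.
- by have [+ _] := H F b; rewrite lincomb_lcomb normL2sq_sqnorm lee_fin.
- by have [_] := H F b; rewrite lincomb_lcomb normL2sq_sqnorm lee_fin.
Qed.

Lemma riesz_basisP A B : 0 < A -> A <= B -> (forall f, in_closure (@L2ip R) e f) ->
  (forall (F : {fset I}) b, A * \sum_(i <- F) nsq (b i) <= q (lcomb e F b)) ->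
  (forall (F : {fset I}) b, q (lcomb e F b) <= B * \sum_(i <- F) nsq (b i)) ->
  is_riesz_basis ef.
Proof.
move=> A0 AB dense low up; split.
- by move=> i; exact: L2spaceP.
- move=> f hf eps e0; have [_ [F [b ->]] fw] := dense (toL2 hf) _ e0.
  by exists F, b; rewrite lincomb_lcomb -sqnorm_toL2B lte_fin.
- exists A, B; split => // F b.
  by rewrite lincomb_lcomb normL2sq_sqnorm !lee_fin; split; [exact: low | exact: up].
Qed.

End FrameBounds.

Theorem theorem3p3 (R : realType) (a : R) (L : nat) (psi : 'I_L -> R -> R[i])
  (a_gt1 : 1 < a)
  (psi_L2 : forall l : 'I_L, L2 (psi l))
  (psi_distinct : forall l l' : 'I_L, eqL2 (psi l) (psi l') -> l = l')
  (psi_frame : is_frame (MD psi a)) :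
  is_riesz_basis (MD psi a) <-> L = 1%N.
Proof.
pose G : zmodType := (int * int)%type.
pose gen l (g : G) : @L2space R := toL2 (L2_atom a_gt1 g (psi_L2 l)).
pose md (i : int * int * 'I_L) : @L2space R := gen i.2 i.1.
have mdE : MD psi a = (fun i => md i : R -> R[i]) by apply/funext => -[[m j] l].
rewrite mdE; have [A [B [A0 AB low up]]] : exists A B : R, [/\ 0 < A, A <= B,
    lower_frame_bound (@L2ip R) md A & upper_frame_bound (@L2ip R) md B].
  by apply: frame_boundsP; rewrite -mdE.
have B0 : 0 < B by exact: lt_le_trans AB.
have on : orthonormal (@L2ip R) (box_atom a_gt1).
  by move=> g h; exact: atom_box_orthonormal.
have st l : stationary (@L2ip R) (box_atom a_gt1) (gen l).
  by move=> g h; exact: inner_atom (@L2_box R a) (psi_L2 l).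
split.
- move=> /riesz_boundsP [A' [B' [A'0 A'B' low' up']]].
  have B'0 : 0 < B' by exact: lt_le_trans A'B'.
  have lcomb_gen l F b :
      lcomb md [fset (g, l) | g : G in F]%fset b = lcomb (gen l) F (fun g => b (g, l)).
    by rewrite /lcomb big_imfset//= => x y _ _ [].
  have up_gen l (F : {fset G}) b : sqnorm (@L2ip R) (lcomb (gen l) F b) <=
      B' * \sum_(g <- F) nsq (b g).
    have := up' [fset (g, l) | g : G in F]%fset (fun i => b i.1).
    by rewrite lcomb_gen big_imfset//= => x y _ _ [].
  apply/eqP; rewrite eqn_leq; apply/andP; split; last first.
  + rewrite lt0n; apply/eqP => L0.
    have := low (box_atom a_gt1 0) 0.
    rewrite /sqnorm on eqxx mulr1 => /(_ _)/wrap[].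
      by move=> F; rewrite big1_fset// => -[? l]; have := leq_trans (ltn_ord l) (eq_leq L0).
    by rewrite leNgt A0.
  + rewrite leqNgt; apply/negP => L2.
    pose l0 : 'I_L := Ordinal (ltnW L2); pose l1 : 'I_L := Ordinal L2.
    apply: (no_two_stationary_generators on (st l0) (st l1) A'0 B'0
      (box_atom_dense a_gt1) (up_gen l0) (up_gen l1)) => F b1 b2.
    pose b (i : G * 'I_L) := if i.2 == l0 then b1 i.1 else - b2 i.1.
    pose E0 := [fset (g, l0) | g : G in F]%fset.
    pose E1 := [fset (g, l1) | g : G in F]%fset.
    have dE : [disjoint E1 & E0]%fset.
      apply/fdisjointP => i /imfsetP[g /= _ ->]; apply/negP => /imfsetP[h /= _ []].
      by [].
    have sumE (M : nmodType) (f : _ -> M) : \sum_(i <- (E0 `|` E1)%fset) f i =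
        \sum_(g <- F) f (g, l0) + \sum_(g <- F) f (g, l1).
      rewrite (sum_fsetD _ (fsubsetUl E0 E1)) fsetDUl fsetDv fset0U.
      move/fsetDidPl : dE => ->.
      by rewrite !big_imfset//= => x y _ _ [].
    have -> : lcomb (gen l0) F b1 - lcomb (gen l1) F b2 = lcomb md (E0 `|` E1)%fset b.
      rewrite /lcomb sumE -sumrN; congr (_ + _); apply: eq_bigr => g _.
      by rewrite /b/= -scaleNr.
    have -> : \sum_(g <- F) (nsq (b1 g) + nsq (b2 g)) =
        \sum_(i <- (E0 `|` E1)%fset) nsq (b i).
      by rewrite sumE -big_split/=; apply: eq_bigr => g _; rewrite /b/= nsqN.
    exact: low'.
- move=> L1; subst L.
  have gen_md i : md i = gen ord0 i.1 by rewrite /md ord1.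
  have inj (F : {fset int * int * 'I_1}) : {in F &, injective (fst : _ -> G)}.
    by move=> [g l] [h l'] _ _ /= ->; rewrite (ord1 l) (ord1 l').
  have low0 : lower_frame_bound (@L2ip R) (gen ord0) A.
    move=> f s hs; apply: low => F.
    rewrite (_ : \sum_(i <- F) _ =
      \sum_(g <- [fset i.1 | i in F]%fset) nsq (L2ip f (gen ord0 g))).
      exact: hs.
    by rewrite big_imfset; [apply: eq_bigr => i _; rewrite gen_md | exact: inj].
  apply: (riesz_basisP A0 AB).
  + by move=> f; exact: frame_dense A0 B0 low up f.
  + move=> F b.
    have := stationary_lower_synthesis_bound on (st ord0) low0
      [fset i.1 | i in F]%fset (fun g => b (g, ord0)).
    rewrite /lcomb !big_imfset//=; try exact: inj.
    have E i : b (i.1, ord0) = b i by case: i => g l; rewrite (ord1 l).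
    by under eq_bigr do rewrite E; under [X in _ <= _ X -> _]eq_bigr do rewrite E -gen_md.
  + exact: synthesis_bound.
Qed.
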